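(* Let $K$ be a field, let $n\ge 2$ and $1\le a<n$ be integers, and let $t=\gcd(2n,a)$. Let $G=C_{2n}(a,n)$ be the cubic circulant graph, and let $I(G)\subset K[V(G)]$ be its edge ideal. (a) If $\frac{2n}{t}$ is even, then $$\operatorname{depth}\big(K[V(G)]/I(G)\big)=\begin{cases}\left\lceil\frac{n}{2t}\right\rceil\cdot t, & \text{if } \frac{n}{t}\equiv 1 \pmod 4,\\[1ex] \left\lceil\frac{n-t}{2t}\right\rceil\cdot t, & \text{otherwise.}\end{cases}$$ (b) If $\frac{2n}{t}$ is odd, then $$\operatorname{depth}\big(K[V(G)]/I(G)\big)=\begin{cases}\left\lceil\frac{2n-t}{2t}\right\rceil\cdot \frac{t}{2}, & \text{if } \frac{2n}{t}\equiv 1 \pmod 4,\\[1ex] \left\lceil\frac{n}{t}\right\rceil\cdot \frac{t}{2}, & \text{if } \frac{2n}{t}\equiv 3 \pmod 4.\end{cases}$$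
   Context: For a finite simple graph $G$, $K[V(G)]$ is the polynomial ring over $K$ (standard grading) whose variables are the vertices of $G$, and the edge ideal is $I(G)=(uv : \{u,v\}\in E(G))$. Depth is taken with respect to the graded maximal ideal generated by all the variables. For $q\ge 2$ and a subset $\mathbb{S}\subseteq\{1,\dots,\lfloor q/2\rfloor\}$, the circulant graph $C_q(\mathbb{S})$ is the graph on vertices $x_1,\dots,x_q$ in which $\{x_i,x_j\}$ ($i\neq j$) is an edge if and only if $|i-j|\in \mathbb{S}$ or $q-|i-j|\in \mathbb{S}$; $C_{2n}(a,n)$ denotes $C_{2n}(\{a,n\})$. *)

(* Defs.v *)
From HB Require Import structures.
From mathcomp Require Import all_boot all_order all_algebra.
From mathcomp Require Import mpoly.

Set Implicit Arguments.
Unset Strict Implicit.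
Unset Printing Implicit Defensive.

Import GRing.Theory.
Local Open Scope ring_scope.

Section Depth.
Variable R : comNzRingType.

(* The ideal of R generated by a set A. *)
Definition ideal_gen (A : R -> Prop) (p : R) : Prop :=
  exists2 s : seq (R * R),
    (forall x, x \in s -> A x.2) & p = \sum_(x <- s) x.1 * x.2.

(* The ideal I + (f_1, ..., f_k), so that (R/I)/(f_1, ..., f_k)(R/I) is the
   quotient of R by it. *)
Definition ideal_add (I : R -> Prop) (fs : seq R) : R -> Prop :=
  ideal_gen (fun g => I g \/ g \in fs).

(* fs is an (R/I)-regular sequence of elements of m. *)
Definition regular_seq (m I : R -> Prop) (fs : seq R) : Prop :=
  [/\ forall f, f \in fs -> m f,
      forall i, (i < size fs)%N -> forall p,
        ideal_add I (take i fs) (fs`_i * p) -> ideal_add I (take i fs) p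
    & ~ ideal_add I fs 1].

(* The depth of R/I with respect to m is d: the largest length of an
   (R/I)-regular sequence in m. *)
Definition depth_quotient (m I : R -> Prop) (d : nat) : Prop :=
  (exists2 fs, regular_seq m I fs & size fs = d) /\
  (forall fs, regular_seq m I fs -> (size fs <= d)%N).

End Depth.

Record sgraph (T : finType) := SGraph {
  edge :> rel T;
  edge_sym : ssrbool.symmetric edge;
  edge_irr : irreflexive edge
}.

(* Vertex x_(i+1) is encoded by i : 'I_q; differences of indices are
   unaffected by the shift.  The expression `|i - j|%N is the distance of i and
   j in nat. *)
Definition circulant_edge (q : nat) (S : seq nat) : rel 'I_q :=
  fun i j => (i != j) &&
    ((`|i - j|%N \in S) || ((q - `|i - j|)%N \in S)).

Lemma circulant_sym q S : ssrbool.symmetric (@circulant_edge q S).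
Proof. by move=> i j; rewrite /circulant_edge eq_sym distnC. Qed.

Lemma circulant_irr q S : irreflexive (@circulant_edge q S).
Proof. by move=> i; rewrite /circulant_edge eqxx. Qed.

Definition circulant (q : nat) (S : seq nat) : sgraph 'I_q :=
  SGraph (@circulant_sym q S) (@circulant_irr q S).

Section EdgeIdeal.
Variables (K : fieldType) (q : nat).

Definition edge_ideal (G : sgraph 'I_q) : {mpoly K[q]} -> Prop :=
  ideal_gen (fun g => exists u v : 'I_q, G u v /\ g = 'X_u * 'X_v).

Definition graded_max_ideal : {mpoly K[q]} -> Prop :=
  ideal_gen (fun g => exists u : 'I_q, g = 'X_u).

(* depth (K[V(G)] / I(G)) = d *)
Definition edge_depth (G : sgraph 'I_q) (d : nat) : Prop :=
  depth_quotient graded_max_ideal (edge_ideal G) d.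

End EdgeIdeal.

(* Main.v *)
Require Import Defs.
From HB Require Import structures.
From mathcomp Require Import all_boot all_order all_algebra.
From mathcomp Require Import mpoly.
From mathcomp Require Import zify ring lra.

Set Implicit Arguments.
Unset Strict Implicit.
Unset Printing Implicit Defensive.

Import Order.TTheory GRing.Theory Num.Theory.
Local Open Scope ring_scope.

(** Let g = gcd(a, n), m = n / g and s = a + n.  A vertex v of C_2n(a, n) is
    joined to v + n and to v + n + s, v + n - s.  Hence, in each of the g
    cosets of the subgroup generated by a and n, the two rows y_k = c + k s and
    z_k = c + k s + n form a ladder in which y_k is joined to z_(k-1), z_k and
    z_(k+1).  The ladder closes up after m columns, and it then exchanges its
    two rows exactly when (a + n) / g is odd ([vertex_edge]).  The depth is g
    times the number [cladder_depth] found for one such circular ladder.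

    Lower bound.  Let I be the ideal of a graph with vertex set U and v in U.
    In the exact sequence
      0 -> K[U] / (I : x_v) -> K[U] / I -> K[U] / (I, x_v) -> 0
    the outer terms are the rings attached to U minus the neighbours of v and
    to U minus v.  Branching in this way until every set is independent
    ([shedding]) shows that a sequence is regular on K[U] / I as soon as it is
    regular on the polynomial rings at the leaves.  If all leaves have at least
    d vertices, the elementary symmetric polynomials s_1, ..., s_d are such a
    sequence, over every field ([esym_seq_regular_indep],
    [regular_seq_of_shedding]).  On a circular ladder one branches on y_0, y_1,
    y_2, ... in turn: selecting y_i leaves isolated vertices and an open ladder
    with oblique ends, and branching at a corner of an open ladder gives open
    ladders again, with a recursion of period four ([shedding_strip],
    [shedding_cladder]).

    Upper bound.  A regular sequence of length r in the maximal ideal kills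
    the local cohomology in degrees below r.  Written with the Koszul cochains
    of the powers of the variables, this is an elementary statement on
    functions on sets of vertices ([lc_vanish_nzd_seq]), and one non-trivial
    class in degree d bounds the depth by d.  Two kinds of classes are used: a
    maximal independent set with d elements ([regular_seq_le_facet]), and a
    product of d sums over disjoint blocks of vertices, detected by a
    cross-polytope of independent sets ([regular_seq_le_blocks]).  For odd m
    the set of alternating vertices in the even columns is maximal independent
    for one of the two ways to close the ladder; for the other way the blocks
    are the leaves of stars centred at z_1, y_3, z_5, ..., and for even m they
    are the y-vertices of pairs of columns. *)

(** * Ideals and regular sequences *)

Section Ideals.
Variable R : comNzRingType.
Implicit Types (I J : R -> Prop) (fs : seq R).

Definition is_ideal J :=
  [/\ J 0, forall p q, J p -> J q -> J (p + q) & forall p q, J q -> J (p * q)].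

Definition add_elt J f : R -> Prop := fun p => exists g, J (p - f * g).

(** The non-zero-divisor condition on a regular sequence, arranged for
    induction on the sequence: the ideal grows by one element at each step. *)
Fixpoint nzd_seq J fs : Prop :=
  if fs is f :: fs' then
    (forall p, J (f * p) -> J p) /\ nzd_seq (add_elt J f) fs'
  else True.

Lemma ideal0 J : is_ideal J -> J 0.
Proof. by case. Qed.

Lemma idealM J p q : is_ideal J -> J q -> J (p * q).
Proof. by case=> _ _; apply. Qed.

Lemma ideal_opp J p : is_ideal J -> J p -> J (- p).
Proof. by case=> _ _ JM Jp; rewrite -mulN1r; exact: JM. Qed.

Lemma ideal_sub J p q : is_ideal J -> J p -> J q -> J (p - q).
Proof.
move=> iJ Jp Jq; case: (iJ) => _ JD _.
by apply: JD => //; apply: ideal_opp.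
Qed.

Lemma ideal_sum J (T : Type) (r : seq T) (P : pred T) (F : T -> R) :
  is_ideal J -> (forall x, P x -> J (F x)) -> J (\sum_(x <- r | P x) F x).
Proof. by case=> J0 JD _ JF; apply: (big_ind J). Qed.

Lemma ideal_trans J p q : is_ideal J -> J (p - q) -> J q -> J p.
Proof. by case=> _ JD _ Jpq Jq; rewrite -(subrK q p); apply: JD. Qed.

Lemma add_elt_ideal J f : is_ideal J -> is_ideal (add_elt J f).
Proof.
move=> iJ; case: (iJ) => J0 JD JM; split.
- by exists 0; rewrite mulr0 subr0.
- move=> p q [g Jg] [h Jh]; exists (g + h).
  have -> : p + q - f * (g + h) = (p - f * g) + (q - f * h) by ring.
  exact: JD.
- move=> p q [g Jg]; exists (p * g).
  have -> : p * q - f * (p * g) = p * (q - f * g) by ring.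
  exact: JM.
Qed.

Lemma sub_add_elt J f p : is_ideal J -> J p -> add_elt J f p.
Proof. by move=> _ Jp; exists 0; rewrite mulr0 subr0. Qed.

Lemma mem_add_elt J f : is_ideal J -> add_elt J f f.
Proof. by case=> J0 _ _; exists 1; rewrite mulr1 subrr. Qed.

Lemma add_elt_ext J J' f : (forall p, J p <-> J' p) ->
  forall p, add_elt J f p <-> add_elt J' f p.
Proof. by move=> e p; split=> -[g /e Jg]; exists g. Qed.

Lemma nzd_seq_ext J J' fs : (forall p, J p <-> J' p) ->
  nzd_seq J fs -> nzd_seq J' fs.
Proof.
elim: fs J J' => //= f fs IH J J' e [Jf Jfs]; split.
  by move=> p /e/Jf/e.
by apply: IH Jfs; apply: add_elt_ext.
Qed.

Lemma ideal_gen_ideal (A : R -> Prop) : is_ideal (ideal_gen A).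
Proof.
split; first by exists [::]; rewrite ?big_nil.
- move=> p q [s As ->] [s' As' ->]; exists (s ++ s'); last by rewrite big_cat.
  by move=> x; rewrite mem_cat => /orP[/As|/As'].
- move=> p q [s As ->]; exists [seq (p * x.1, x.2) | x <- s].
    by move=> x /mapP[y /As Ay ->].
  by rewrite big_map mulr_sumr; apply: eq_bigr => x _; rewrite mulrA.
Qed.

Lemma mem_ideal_gen (A : R -> Prop) p : A p -> ideal_gen A p.
Proof.
move=> Ap; exists [:: (1, p)]; last by rewrite big_seq1 mul1r.
by move=> x; rewrite inE => /eqP ->.
Qed.

Lemma ideal_gen_min (A J : R -> Prop) p : is_ideal J ->
  (forall q, A q -> J q) -> ideal_gen A p -> J p.
Proof.
move=> iJ AJ [s As ->]; rewrite big_seq; apply: ideal_sum => // x xs.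
by case: iJ => _ _; apply; apply/AJ/As.
Qed.

Lemma foldl_add_elt_ideal J fs : is_ideal J -> is_ideal (foldl add_elt J fs).
Proof. by elim: fs J => //= f fs IH J iJ; apply/IH/add_elt_ideal. Qed.

Lemma ideal_addE J fs p : is_ideal J ->
  ideal_add J fs p <-> foldl add_elt J fs p.
Proof.
move=> iJ; split.
  apply: ideal_gen_min; first exact: foldl_add_elt_ideal.
  elim: fs J iJ => [|f fs IH] J iJ q /=; first by case.
  case=> [Jq|].
    by apply: (IH _ (add_elt_ideal f iJ)); left; apply: sub_add_elt.
  rewrite inE => /orP[/eqP->|qfs]; last first.
    by apply: (IH _ (add_elt_ideal f iJ)); right.
  by apply: (IH _ (add_elt_ideal f iJ)); left; apply: mem_add_elt.
suff min K : is_ideal K -> (forall q, J q -> K q) ->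
    (forall f, f \in fs -> K f) -> foldl add_elt J fs p -> K p.
  apply: min => [|q Jq|f ffs]; first exact: ideal_gen_ideal.
    by apply: mem_ideal_gen; left.
  by apply: mem_ideal_gen; right.
move=> iK; elim: fs J {iJ} => [|f fs IH] J JK fsK /=; first exact: JK.
apply: IH => [q [g Jg]|q qfs]; last by apply: fsK; rewrite inE qfs orbT.
apply: (ideal_trans iK (JK _ Jg)); rewrite mulrC.
by case: iK => _ _; apply; apply: fsK; rewrite mem_head.
Qed.

Lemma nzd_seqP J fs : is_ideal J -> nzd_seq J fs <->
  (forall i, (i < size fs)%N -> forall p,
     ideal_add J (take i fs) (fs`_i * p) -> ideal_add J (take i fs) p).
Proof.
elim: fs J => [|f fs IH] J iJ /=; first by split.
have iJf := add_elt_ideal f iJ; split.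
  case=> Jf /(IH _ iJf) reg [|i] ltis p /=.
    by move=> /(ideal_addE _ _ iJ) /Jf Jp; apply/(ideal_addE _ _ iJ).
  move=> /(ideal_addE _ _ iJ) /= /(ideal_addE _ _ iJf) /(reg _ ltis).
  by move=> /(ideal_addE _ _ iJf) Jp; apply/(ideal_addE _ _ iJ).
move=> reg; split=> [p Jfp|].
  apply/(ideal_addE [::] _ iJ)/(reg 0%N) => //=.
  exact/(ideal_addE [::] _ iJ).
apply/(IH _ iJf) => i ltis p /(ideal_addE _ _ iJf) Jp.
apply/(ideal_addE _ _ iJf)/(ideal_addE (f :: take i fs) _ iJ)/(reg i.+1) => //=.
exact/(ideal_addE _ _ iJ).
Qed.

(** Regularity passes from the ends to the middle of the exact sequence
    0 -> R / (J : x) -> R / J -> R / (J, x) -> 0, and the sequence stays exact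
    modulo each regular element: if x p lies in (J, f), regularity of f modulo
    (J, x) allows to correct p by a multiple of f so that x p lies in J. *)
Lemma nzd_seq_colon J x fs : is_ideal J ->
  nzd_seq (fun p => J (x * p)) fs -> nzd_seq (add_elt J x) fs -> nzd_seq J fs.
Proof.
elim: fs J => //= f fs IH J iJ [regc regfsc] [rega regfsa]; split.
  move=> p Jfp; have [h Jh] := rega _ (sub_add_elt x iJ Jfp).
  apply: (ideal_trans iJ Jh); apply: regc.
  have -> : x * (f * h) = f * p - f * (p - x * h) by ring.
  by apply: ideal_sub => //; case: iJ => _ _; apply.
apply: IH; first exact: add_elt_ideal.
  apply: nzd_seq_ext regfsc => p; split=> [[g Jg]|[g Jg]].
    by exists (x * g); rewrite mulrCA -mulrBr.
  have /rega [h Jh] : add_elt J x (f * g).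
    by exists p; have := ideal_opp iJ Jg; rewrite opprB.
  exists h; have -> : x * (p - f * h) = (x * p - f * g) + f * (g - x * h)
    by ring.
  by case: iJ => _ JD JM; apply: JD => //; apply: JM.
apply: nzd_seq_ext regfsa => p.
split=> -[g [h Jgh]]; exists h; exists g.
  by have -> : p - x * h - f * g = p - f * g - x * h by ring.
by have -> : p - f * h - x * g = p - x * g - f * h by ring.
Qed.

Lemma nzd_seq_rcons J fs f :
  nzd_seq J fs -> (forall p, foldl add_elt J fs (f * p) ->
                             foldl add_elt J fs p) ->
  nzd_seq J (rcons fs f).
Proof.
elim: fs J => [|f' fs IH] J /=; first by move=> _ Jf.
by case=> Jf' Jfs Jf; split=> //; apply: IH.
Qed.

Lemma sub_foldl_add_elt J fs p :
  is_ideal J -> J p -> foldl add_elt J fs p.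
Proof.
elim: fs J => //= f fs IH J iJ Jp; apply: IH; first exact: add_elt_ideal.
exact: sub_add_elt.
Qed.

End Ideals.

(** * Independent sets and branching *)

Section Graphs.
Variables (T : finType) (e : rel T).

Definition indep (A : {set T}) : bool :=
  [forall u in A, [forall v in A, ~~ e u v]].

Definition nbhd (v : T) : {set T} := [set w | e v w].

Lemma indepP (A : {set T}) : reflect {in A &, forall u v, ~~ e u v} (indep A).
Proof.
apply: (iffP forall_inP) => [H u v uA vA|H u uA].
  by have /forall_inP := H _ uA; apply.
by apply/forall_inP => v vA; apply: H.
Qed.

Lemma indepS (A B : {set T}) : A \subset B -> indep B -> indep A.
Proof.
move=> /subsetP sAB /indepP iB; apply/indepP => u v uA vA.
by apply: iB; apply: sAB.
Qed.

(** A decision tree on the induced subgraph on U: at each node a vertex is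
    deleted, or selected, in which case its neighbours disappear.  A selected
    vertex stays in the set, where it is isolated from then on, so that the
    size of a leaf counts selected and never selected vertices alike. *)
Inductive shedding (U : {set T}) (d : nat) : Prop :=
| shedding_indep of indep U & (d <= #|U|)%N
| shedding_split v of v \in U & shedding (U :\ v) d
    & shedding (U :\: nbhd v) d.

End Graphs.

(** * Coefficients and homogeneous components *)

Section Monomials.
Variables (K : fieldType) (q : nat).
Implicit Types (p g : {mpoly K[q]}) (m k : 'X_{1..q}).

Lemma mcoeffMX_if p m k :
  (p * 'X_[m])@_k = if (m <= k)%MM then p@_(k - m)%MM else 0.
Proof.
case: ifP => [le_mk|nle_mk].
  by rewrite -[k in LHS](submK le_mk) addmC mcoeffMX.
apply: memN_msupp_eq0; rewrite (perm_mem (msuppMX _ _)).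
apply/mapP => -[k' _ def_k]; case/negP: nle_mk; rewrite def_k.
exact: lem_addr.
Qed.

Lemma mcoeff_msupp_part p (P : pred 'X_{1..q}) k :
  (\sum_(m <- msupp p | P m) p@_m *: 'X_[m])@_k = if P k then p@_k else 0.
Proof.
rewrite raddf_sum /= (eq_bigr (fun m => (m == k)%:R * p@_m)); last first.
  by move=> m _; rewrite mcoeffZ mcoeffX mulrC.
case: (boolP (k \in msupp p)) => [kp|/[dup] kp /memN_msupp_eq0 pk0]; last first.
  rewrite pk0 if_same big_seq_cond big1 // => m /andP[mp _].
  by case: eqP => [mk|]; [rewrite -mk mp in kp | rewrite mul0r].
rewrite big_mkcond (bigD1_seq k) //= eqxx mul1r big1 ?addr0 // => m /negPf ->.
by rewrite mul0r if_same.
Qed.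

Lemma mcoeff_pihomog d p k :
  (pihomog mdeg d p)@_k = if mdeg k == d then p@_k else 0.
Proof. by rewrite pihomogE mcoeff_msupp_part. Qed.

Lemma pihomogM d i f g : f \is i.-homog ->
  pihomog mdeg d (f * g) =
    if (i <= d)%N then f * pihomog mdeg (d - i) g else 0.
Proof.
move=> fi; have [N leN] : exists N, (mmeasure mdeg g <= N)%N.
  by exists (mmeasure mdeg g).
have leN' : (mmeasure mdeg g <= maxn N d.+1)%N by rewrite leq_max leN.
rewrite {1}(pihomog_partitionE leN') mulr_sumr raddf_sum /=.
have E (j : 'I_(maxn N d.+1)) : pihomog mdeg d (f * pihomog mdeg j g) =
    if (i + j == d)%N then f * pihomog mdeg j g else 0.
  have h : f * pihomog mdeg j g \is (i + j).-homog.
    by apply: dhomogM => //; apply: pihomogP.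
  case: eqP => [ijd|/eqP ne]; last exact: pihomog_ne0 ne h.
  by apply: pihomog_dE; rewrite -[X in X.-homog]ijd.
rewrite (eq_bigr _ (fun j _ => E j)); case: ifP => lid; last first.
  by apply: big1 => j _; case: eqP => // jd; rewrite -jd leq_addr in lid.
have ltd : (d - i < maxn N d.+1)%N by rewrite leq_max ltnS leq_subr orbT.
rewrite (bigD1 (Ordinal ltd)) //= subnKC // eqxx big1 ?addr0 // => j.
by move=> /eqP ne; case: eqP => // jd; case: ne; apply: val_inj => /=; lia.
Qed.

Definition homog_closed (J : {mpoly K[q]} -> Prop) :=
  forall d p, J p -> J (pihomog mdeg d p).

Lemma add_elt_homog J i f : is_ideal J -> homog_closed J -> f \is i.-homog ->
  homog_closed (add_elt J f).
Proof.
move=> iJ hJ fi d p [g /(hJ d)]; rewrite raddfB /= (pihomogM _ _ fi).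
case: ifP => _ Jg; last by exists 0; rewrite mulr0.
by exists (pihomog mdeg (d - i) g).
Qed.

(** In degree d, the multiple of x_u ^ N has no component once N > d. *)
Lemma homog_separated J (u : 'I_q) p : is_ideal J -> homog_closed J ->
  (forall N, exists g, J (p - 'X_u ^+ N * g)) -> J p.
Proof.
move=> iJ hJ Jp; rewrite (pihomog_partitionE (leqnn (mmeasure mdeg p))).
apply: ideal_sum => // d _; have [g /(hJ d)] := Jp d.+1.
rewrite raddfB /= (@pihomogM _ d.+1); first by rewrite ltnn subr0.
rewrite mpolyXn; apply/dhomogP => m; rewrite msuppX inE => /eqP ->.
by rewrite /= [LHS]mdegMn mdeg1 mul1n.
Qed.

(** A homogeneous sequence that is regular modulo (J, x) is regular modulo J
    when x is, and x stays regular modulo the sequence.  Indeed f p in J gives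
    p = x p' modulo J, then x f p' in J and f p' in J: by iteration p lies in
    (J, x ^ N) for every N. *)
Lemma nzd_seq_lift J (u : 'I_q) fs : is_ideal J -> homog_closed J ->
  (forall p, J ('X_u * p) -> J p) ->
  (forall f, f \in fs -> exists i, f \is i.-homog) ->
  nzd_seq (add_elt J 'X_u) fs ->
  nzd_seq J fs /\
  (forall p, foldl (@add_elt _) J fs ('X_u * p) -> foldl (@add_elt _) J fs p).
Proof.
elim: fs J => //= f fs IH J iJ hJ Jx hfs [regf regfs].
have regJf p : J (f * p) -> J p.
  move=> Jfp; apply: (homog_separated (u := u)) => // N.
  suff [g [Jg _]] : exists g, J (p - 'X_u ^+ N * g) /\ J (f * g) by exists g.
  elim: N => [|N [g [Jg Jfg]]].
    by exists p; rewrite expr0 mul1r subrr; case: (iJ).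
  have [h Jh] := regf _ (sub_add_elt _ iJ Jfg).
  exists h; split.
    have -> : p - 'X_u ^+ N.+1 * h =
        (p - 'X_u ^+ N * g) + 'X_u ^+ N * (g - 'X_u * h) by rewrite exprS; ring.
    by case: (iJ) => _ JD JM; apply: JD => //; apply: JM.
  apply: Jx; apply: (ideal_trans (q := f * g)) => //.
  have -> : 'X_u * (f * h) - f * g = - f * (g - 'X_u * h) by ring.
  by case: (iJ) => _ _; apply.
have [i fi] := hfs f (mem_head _ _).
have regxf p : add_elt J f ('X_u * p) -> add_elt J f p.
  case=> g Jg; have /regf [h Jh] : add_elt J 'X_u (f * g).
    by exists p; have := ideal_opp iJ Jg; rewrite opprB.
  exists h; apply: Jx.
  have -> : 'X_u * (p - f * h) = ('X_u * p - f * g) + f * (g - 'X_u * h)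
    by ring.
  by case: (iJ) => _ JD JM; apply: JD => //; apply: JM.
have [|||reg1 reg2] := IH (add_elt J f) (add_elt_ideal f iJ) _ regxf.
- exact: add_elt_homog fi.
- by move=> g gfs; apply: hfs; rewrite inE gfs orbT.
- apply: nzd_seq_ext regfs => p.
  split=> -[g [h Jgh]]; exists h; exists g.
    by have -> : p - 'X_u * h - f * g = p - f * g - 'X_u * h by ring.
  by have -> : p - f * h - 'X_u * g = p - 'X_u * g - f * h by ring.
by [].
Qed.

End Monomials.

(** * The ideal of an induced subgraph *)

Section StanleyReisner.
Variables (K : fieldType) (q : nat) (G : sgraph 'I_q).
Implicit Types (p g : {mpoly K[q]}) (m k : 'X_{1..q}) (U : {set 'I_q}).

Definition supp m : {set 'I_q} := [set u | m u != 0%N].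

(** The ideal generated by the variables outside U and the edges inside U.
    A monomial survives in the quotient if its support is an independent
    subset of U; reading off coefficients makes both the colon ideal and the
    sum with a variable immediate. *)
Definition sr_ideal U : {mpoly K[q]} -> Prop :=
  fun p => forall m, supp m \subset U -> indep G (supp m) -> p@_m = 0.

Lemma supp_mono m k : (m <= k)%MM -> supp m \subset supp k.
Proof.
move/mnm_lepP => le_mk; apply/subsetP => u; rewrite !inE -!lt0n => /leq_trans.
exact.
Qed.

Lemma sr_ideal_ideal U : is_ideal (sr_ideal U).
Proof.
split=> [m _ _|p g Jp Jg m mU mi|p g Jg m mU mi]; first exact: mcoeff0.
  by rewrite mcoeffD Jp ?Jg ?addr0.
rewrite mcoeffM big1 // => k /eqP mk.
have le_km : supp k.2 \subset supp m.
  by apply: supp_mono; rewrite [X in (_ <= X)%MM]mk lem_addl.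
rewrite Jg ?mulr0 //; first exact: subset_trans mU.
exact: indepS mi.
Qed.

Lemma sr_ideal_homog U : homog_closed (sr_ideal U).
Proof.
by move=> d p Jp m mU mi; rewrite mcoeff_pihomog Jp // if_same.
Qed.

Lemma mnm1_leE (u : 'I_q) m : (U_(u) <= m)%MM = (m u != 0%N).
Proof.
rewrite -lt0n; apply/mnm_lepP/idP => [/(_ u)|mu i]; first by rewrite mnm1E eqxx.
by rewrite mnm1E; case: eqP => // <-.
Qed.

Lemma sr_ideal_colon U v p : v \in U ->
  sr_ideal U ('X_v * p) <-> sr_ideal (U :\: nbhd G v) p.
Proof.
move=> vU; split=> Jp m mU mi; last first.
  rewrite mulrC mcoeffMX_if mnm1_leE; case: ifP => // mv.
  have smv : supp (m - U_(v)) \subset supp m.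
    by apply/supp_mono/mnm_lepP => i; rewrite mnmBE leq_subr.
  apply: Jp; last exact: indepS mi.
  rewrite subsetD (subset_trans smv mU) /= disjoint_subset.
  apply/subsetP => u /(subsetP smv) us; rewrite !inE.
  by apply: (indepP _ _ mi) => //; rewrite inE.
have <- : ('X_v * p)@_(U_(v) + m) = p@_m by rewrite mulrC mcoeffMX.
have sE : supp (U_(v) + m) = v |: supp m.
  apply/setP => u; rewrite !inE mnmDE mnm1E (eq_sym v).
  by case: (u == v).
move: mU; rewrite subsetD => /andP[mU /disjoint_setI0 mN].
apply: Jp; rewrite sE; first by rewrite subUset sub1set vU.
have nb u : u \in supp m -> ~~ G v u.
  by move=> us; apply/negP => vu; have := in_set0 u;
    rewrite -mN !inE vu in us *; rewrite us.
apply/indepP => u w; rewrite !in_setU1.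
case/orP=> [/eqP->|us] /orP[/eqP->|ws].
- by rewrite edge_irr.
- exact: nb.
- by rewrite edge_sym nb.
- exact: (indepP _ _ mi).
Qed.

Lemma sr_ideal_add U v p :
  add_elt (sr_ideal U) 'X_v p <-> sr_ideal (U :\ v) p.
Proof.
split=> [[g Jg] m mU mi|Jp].
  have mv : m v = 0%N.
    apply/eqP/negP => /negP mv; have : v \in supp m by rewrite inE.
    by move/(subsetP mU); rewrite !inE eqxx.
  have := Jg m (subset_trans mU (subsetDl _ _)) mi.
  by rewrite mcoeffB mulrC mcoeffMX_if mnm1_leE mv eqxx /= subr0.
exists (\sum_(m <- msupp p | m v != 0%N) p@_m *: 'X_[m - U_(v)]) => m mU mi.
have -> : 'X_v * \sum_(m <- msupp p | m v != 0%N) p@_m *: 'X_[m - U_(v)]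
    = \sum_(m <- msupp p | m v != 0%N) p@_m *: 'X_[m] :> {mpoly K[q]}.
  rewrite mulr_sumr; apply: eq_bigr => k; rewrite -mnm1_leE => vk.
  by rewrite -scalerAr -mpolyXD addmC submK.
rewrite mcoeffB mcoeff_msupp_part; case: ifP => [|/negbFE mv].
  by rewrite subrr.
rewrite subr0 Jp //; apply/subsetP => u us; rewrite !inE (subsetP mU) // andbT.
by apply/eqP => uv; rewrite uv inE mv in us.
Qed.

Lemma edge_idealE p : edge_ideal G p <-> sr_ideal setT p.
Proof.
split.
  apply: ideal_gen_min; first exact: sr_ideal_ideal.
  move=> _ [u [v [uv ->]]] m _ /indepP mi; rewrite mcoeffMX_if mnm1_leE.
  case: ifP => // mv; rewrite mcoeffX; case: eqP => // um.
  have mu : m u != 0%N.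
    by apply: contraTneq uv => mu; move/mnmP/(_ u): um;
      rewrite mnmBE mnm1E eqxx mu.
  by have := mi u v; rewrite !inE mu mv uv => /(_ isT isT).
move=> Jp; rewrite (mpolyE p); apply: ideal_sum => [|m _].
  exact: ideal_gen_ideal.
case: (boolP (indep G (supp m))) => [mi|].
  rewrite (Jp m (subsetT _) mi) scale0r.
  exact: ideal0 (ideal_gen_ideal _).
rewrite negb_forall_in => /exists_inP[u us].
rewrite negb_forall_in => /exists_inP[v vs]; rewrite negbK => uv.
have le_m : (U_(u) + U_(v) <= m)%MM.
  apply/mnm_lepP => i; rewrite mnmDE !mnm1E.
  move: us vs; rewrite !inE -!lt0n => mu mv.
  case: (eqVneq u i) mu => [<- mu|_ _]; last by case: eqP => [<-|].
  by case: eqP uv => [->|]; [rewrite edge_irr|].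
rewrite -(submK le_m) !mpolyXD scalerAl.
apply: idealM; first exact: ideal_gen_ideal.
by apply: mem_ideal_gen; exists u; exists v.
Qed.

End StanleyReisner.

(** * Branching bounds the depth from below *)

Lemma prod_varE (K : fieldType) q (U : {set 'I_q}) :
  \prod_(u in U) 'X_u = 'X_[mesym1 U] :> {mpoly K[q]}.
Proof.
rewrite mpolyXE_id big_mkcond /=; apply: eq_bigr => i _.
by rewrite mnmE; case: (i \in U).
Qed.

Section LowerBound.
Variables (K : fieldType) (q : nat) (G : sgraph 'I_q).
Implicit Types (p g : {mpoly K[q]}) (U : {set 'I_q}).

(** Linear forms that are regular on all coordinate subspaces of dimension k
    need not exist over a small field; elementary symmetric polynomials are
    regular on all of them over every field. *)
Definition esym_seq (k : nat) : seq {mpoly K[q]} :=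
  mkseq (fun i => mesym q K i.+1) k.

Lemma sr_ideal_mesym U :
  sr_ideal G U (mesym q K #|U| - \prod_(u in U) 'X_u).
Proof.
rewrite prod_varE mesymE (bigD1 U) //= addrAC subrr add0r.
apply: ideal_sum => [|h /andP[/eqP hU neq]]; first exact: sr_ideal_ideal.
move=> m mU _; rewrite mcoeffX; case: eqP => // hm; case/eqP: neq.
apply/eqP; rewrite eqEcard hU leqnn andbT.
apply/subsetP => u uh; apply: (subsetP mU).
by rewrite inE -hm mnmE uh.
Qed.

Lemma sr_ideal_var_regular U u p : indep G U -> u \in U ->
  sr_ideal G U ('X_u * p) -> sr_ideal G U p.
Proof.
move=> /indepP iU uU /(sr_ideal_colon _ _ uU); congr (sr_ideal G _ p).
apply/setP => v; rewrite !inE; case: (boolP (v \in U)) => vU; rewrite ?andbF //.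
by rewrite andbT iU.
Qed.

(** For an independent set U the quotient is the polynomial ring K[U].  If U
    has more than k elements, remove one variable and lift the sequence.  If U
    has exactly k elements, the last polynomial becomes the product of the
    variables in U, and each of them is regular modulo the previous
    polynomials by the first case. *)
Lemma esym_seq_regular_indep U k : indep G U -> (k <= #|U|)%N ->
  nzd_seq (sr_ideal G U) (esym_seq k) /\
  ((k < #|U|)%N -> forall u, u \in U -> forall p,
     foldl (@add_elt _) (sr_ideal G U) (esym_seq k) ('X_u * p) ->
     foldl (@add_elt _) (sr_ideal G U) (esym_seq k) p).
Proof.
have [c] := ubnP #|U|; elim: c U k => // c IH U k; rewrite ltnS => leUc iU.
have lift k' u : (k' < #|U|)%N -> u \in U ->
    nzd_seq (sr_ideal G U) (esym_seq k') /\ (forall p,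
     foldl (@add_elt _) (sr_ideal G U) (esym_seq k') ('X_u * p) ->
     foldl (@add_elt _) (sr_ideal G U) (esym_seq k') p).
  move=> ltk uU; apply: nzd_seq_lift.
  - exact: sr_ideal_ideal.
  - exact: sr_ideal_homog.
  - by move=> p; apply: sr_ideal_var_regular.
  - by move=> _ /mapP[i _ ->]; exists i.+1; apply: dhomog_mesym.
  apply: (nzd_seq_ext (fun p => iff_sym (sr_ideal_add G U u p))).
  have ltUu : (#|U :\ u| < #|U|)%N by rewrite [X in (_ < X)%N](cardsD1 u) uU.
  apply: (proj1 (IH _ k' _ _ _)); first exact: leq_trans leUc.
    exact: indepS (subsetDl _ _) iU.
  by move: ltk; rewrite [X in (_ < X)%N -> _](cardsD1 u) uU.
rewrite leq_eqVlt => /orP[/eqP kU|ltkU]; last first.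
  have [u uU] : exists u, u \in U by apply/card_gt0P; apply: leq_trans ltkU.
  by split=> [|_ v vU]; [case: (lift k u) | case: (lift k v)].
split; last by rewrite kU ltnn.
case: k kU => [|k] kU //.
have [u uU] : exists u, u \in U by apply/card_gt0P; rewrite -kU.
have ltkU : (k < #|U|)%N by rewrite -kU.
rewrite /esym_seq /mkseq -addn1 iotaD map_cat cats1.
apply: nzd_seq_rcons; first by case: (lift k u).
rewrite -/(esym_seq k) /= add0n kU => p Jp.
set J := foldl _ _ _ in Jp *.
have iJ : is_ideal J by apply/foldl_add_elt_ideal/sr_ideal_ideal.
have {Jp} : J (\prod_(u in U) 'X_u * p).
  have -> : \prod_(u in U) 'X_u * p =
    mesym q K #|U| * p - p * (mesym q K #|U| - \prod_(u in U) 'X_u) by ring.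
  apply: ideal_sub => //; case: (iJ) => _ _; apply.
  apply: sub_foldl_add_elt; [exact: sr_ideal_ideal|exact: sr_ideal_mesym].
rewrite -big_enum /=.
have : all (mem U) (enum U) by apply/allP => v; rewrite mem_enum.
elim: (enum U) => [_|v s IHs /= /andP[vU sU]]; first by rewrite big_nil mul1r.
rewrite big_cons -mulrA => Jp; apply: IHs => //.
by case: (lift k v) => // _; apply.
Qed.

Lemma shedding_esym_seq_regular U d : shedding G U d ->
  nzd_seq (sr_ideal G U) (esym_seq d).
Proof.
elim=> {U d} [U d iU dU|U d v vU _ IH1 _ IH2];
  first by case: (esym_seq_regular_indep iU dU).
apply: (nzd_seq_colon (x := 'X_v)); first exact: sr_ideal_ideal.
  by apply: nzd_seq_ext IH2 => p; apply: iff_sym; apply: sr_ideal_colon.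
by apply: nzd_seq_ext IH1 => p; apply: iff_sym; apply: sr_ideal_add.
Qed.

Lemma graded_max_idealE p : graded_max_ideal p <-> p@_0%MM = 0.
Proof.
split=> [|p0].
  pose J g := (g : {mpoly K[q]})@_0%MM = 0; apply: (ideal_gen_min (J := J)).
    split=> [|g h g0 h0|g h h0]; rewrite /J ?mcoeff0 ?mcoeffD ?g0 ?h0 ?addr0 //.
    by rewrite rmorphM /= h0 mulr0.
  by move=> _ [u ->]; rewrite /J mcoeffX mnm1_eq0.
rewrite (mpolyE p); apply: ideal_sum => [|m _]; first exact: ideal_gen_ideal.
case: (eqVneq m 0%MM) => [->|nz].
  by rewrite p0 scale0r; apply: ideal0 (ideal_gen_ideal _).
have [u mu] : exists u, m u != 0%N.
  apply/existsP; apply: contraNT nz => /existsPn m0; apply/eqP/mnmP => i.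
  by rewrite mnm0E; apply/eqP; rewrite -[_ == _]negbK m0.
rewrite -mnm1_leE in mu; rewrite -(submK mu) mpolyXD scalerAl.
apply: idealM; first exact: ideal_gen_ideal.
by apply: mem_ideal_gen; exists u.
Qed.

Theorem regular_seq_of_shedding d : shedding G setT d ->
  regular_seq (@graded_max_ideal K q) (edge_ideal G) (esym_seq d).
Proof.
move=> /shedding_esym_seq_regular reg.
have iI : is_ideal (@edge_ideal K q G) by apply: ideal_gen_ideal.
have mes f : f \in esym_seq d -> graded_max_ideal f.
  by case/mapP => i _ ->; apply/graded_max_idealE;
    rewrite mcoeff_mesym /mechar mdeg0.
split=> //.
  apply/(nzd_seqP _ iI); apply: nzd_seq_ext reg => p.
  exact: (iff_sym (edge_idealE G p)).
move=> I1; suff /graded_max_idealE : @graded_max_ideal K q 1.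
  by rewrite mcoeff1 eqxx => /eqP; rewrite oner_eq0.
apply: ideal_gen_min I1 => [|f []]; [exact: ideal_gen_ideal| |exact: mes].
apply: ideal_gen_min => [|_ [u [v [_ ->]]]]; first exact: ideal_gen_ideal.
apply: idealM; first exact: ideal_gen_ideal.
by apply: mem_ideal_gen; exists v.
Qed.

End LowerBound.

(** * Koszul cochains of powers of the variables *)

Section Koszul.
Variables (R : comNzRingType) (V : finType) (rk : V -> nat) (x : V -> R).
Hypothesis rk_inj : injective rk.
Implicit Types (z w : {set V} -> R) (F : {set V}) (u v : V).

(** The order of the vertices is a parameter [rk]: adapted to a family of
    blocks, it makes all signs that occur in a product of blocks trivial. *)
Definition ksign v F : R := (-1) ^+ #|[set u in F | rk u < rk v]%N|.

Definition kdiff (k : nat) z F : R :=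
  \sum_(v in F) ksign v F * x v ^+ k * z (F :\ v).

Definition xprod F : R := \prod_(v in F) x v.

Lemma ksign_sq v F : ksign v F * ksign v F = 1.
Proof. by rewrite -expr2 sqrr_sign. Qed.

Lemma ksignD1 u v F : u \in F ->
  ksign v (F :\ u) = if (rk u < rk v)%N then - ksign v F else ksign v F.
Proof.
move=> uF; rewrite /ksign.
have -> : [set w in F :\ u | (rk w < rk v)%N] =
  [set w in F | (rk w < rk v)%N] :\ u.
  by apply/setP => w; rewrite !inE andbA.
rewrite [in RHS](cardsD1 u [set w in F | (rk w < rk v)%N]) inE uF /=.
by case: (rk u < rk v)%N; rewrite //= add1n exprS mulN1r opprK.
Qed.

Lemma ksign_self v F : ksign v (F :\ v) = ksign v F.
Proof.
case: (boolP (v \in F)) => vF; first by rewrite ksignD1 // ltnn.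
by congr ksign; apply/setP => w; rewrite !inE; case: eqP vF => // -> /negPf ->.
Qed.

Lemma ksign_anti u v F : u \in F -> v \in F -> u != v ->
  ksign u F * ksign v (F :\ u) = - (ksign v F * ksign u (F :\ v)).
Proof.
move=> uF vF uv; rewrite !ksignD1 //.
have : rk u != rk v by apply: contra uv => /eqP/rk_inj ->.
by case: ltngtP => // _ _; ring.
Qed.

(** The terms for (u, v) and (v, u) cancel; they are matched explicitly,
    because equality with the opposite is not enough in characteristic 2. *)
Lemma kdiff_kdiff k z F : kdiff k (kdiff k z) F = 0.
Proof.
pose t v u :=
  ksign v F * x v ^+ k * (ksign u (F :\ v) * x u ^+ k * z (F :\ v :\ u)).
have -> : kdiff k (kdiff k z) F =
    \sum_(v in F) \sum_(u in F | u != v) t v u.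
  apply: eq_bigr => v vF; rewrite mulr_sumr; apply: eq_bigl => u.
  by rewrite !inE andbC.
have tA u v : u \in F -> v \in F -> u != v -> t v u = - t u v.
  move=> uF vF uv; rewrite /t setDDl [[set v] :|: _]setUC -setDDl.
  transitivity ((ksign v F * ksign u (F :\ v)) *
                (x v ^+ k * x u ^+ k * z (F :\ u :\ v))).
    by ring.
  by rewrite ksign_anti // 1?eq_sym //; ring.
have split_rk v : v \in F -> \sum_(u in F | u != v) t v u =
    \sum_(u in F | (rk u < rk v)%N) t v u +
    \sum_(u in F | (rk v < rk u)%N) t v u.
  move=> vF; rewrite (bigID (fun u => rk u < rk v)%N) /=; congr (_ + _).
    by apply: eq_bigl => u; case: (eqVneq u v) => [->|];
      rewrite ?ltnn ?andbF ?andbT.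
  apply: eq_bigl => u; rewrite -leqNgt leq_eqVlt (inj_eq rk_inj) eq_sym.
  by case: (eqVneq u v) => [->|]; rewrite ?ltnn ?andbF ?andbT.
rewrite (eq_bigr _ split_rk) big_split /=.
rewrite [X in _ + X](exchange_big_dep (mem F)) /=; last by move=> v u _ /andP[].
rewrite -big_split big1 // => v vF /=; apply/eqP; rewrite addr_eq0 -sumrN;
  apply/eqP.
apply: eq_big => [u|u /andP[uF uv]]; first by rewrite vF.
by apply: tA => //; apply: contraTneq uv => ->; rewrite ltnn.
Qed.

Definition contract v z F : R :=
  if v \in F then 0 else ksign v F * z (v |: F).

(** Contraction with v is a homotopy between zero and multiplication by the
    k-th power of x_v. *)
Lemma contract_homotopy k v z F :
  kdiff k (contract v z) F + contract v (kdiff k z) F = x v ^+ k * z F.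
Proof.
rewrite {2}/contract; case: ifP => vF.
  rewrite addr0 /kdiff (bigD1 v) //= big1 ?addr0 => [|u /andP[uF uv]].
    rewrite /contract !inE eqxx /= setD1K // ksign_self.
    transitivity ((ksign v F * ksign v F) * (x v ^+ k * z F)); first by ring.
    by rewrite ksign_sq mul1r.
  by rewrite /contract !inE eq_sym uv vF mulr0.
have vFu u : u \in F -> u != v by move=> uF; apply: contraFneq vF => <-.
rewrite /kdiff big_setU1 ?vF //= mulrDr addrCA setU1K ?vF //.
rewrite -(ksign_self v (v |: F)) setU1K ?vF //.
rewrite 2!mulrA -[ksign v F * _]/(ksign v F * ksign v F) ksign_sq mul1r.
rewrite -[RHS]addr0; congr (_ + _).
rewrite mulr_sumr -big_split big1 //= => u uF.
have -> : (v |: F) :\ u = v |: (F :\ u).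
  by apply/setP => w; rewrite !inE; case: (eqVneq w v) => [->|] //=;
    rewrite eq_sym vFu.
rewrite /contract !inE vF andbF.
have vU : v \in v |: F by rewrite !inE eqxx.
have uU : u \in v |: F by rewrite !inE uF orbT.
have := ksign_anti uU vU (vFu _ uF).
have -> : ksign v ((v |: F) :\ u) = ksign v (F :\ u).
  rewrite -[in LHS]ksign_self; congr ksign; apply/setP => w; rewrite !inE.
  by case: (eqVneq w v) => [->|]; rewrite ?vF ?andbF.
rewrite setU1K ?vF // -(ksign_self v (v |: F)) setU1K ?vF // => anti.
set a := ksign u (v |: F) in anti *; set b := ksign v (F :\ u) in anti *.
set c := ksign v F in anti *; set e := ksign u F in anti *.
have a2 : a * a = 1 by apply: ksign_sq.
have e2 : e * e = 1 by apply: ksign_sq.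
(* Multiply anti by a * e and use that a and e have square 1. *)
have ebca : e * b + c * a = 0.
  transitivity ((a * a) * (e * b) + (e * e) * (c * a));
    first by rewrite a2 e2 !mul1r.
  transitivity (a * e * (a * b) + a * e * (c * e)); first by ring.
  by rewrite anti; ring.
transitivity ((e * b + c * a) * (x u ^+ k * z (v |: F :\ u))); first by ring.
by rewrite ebca mul0r.
Qed.

Lemma kdiffM k a z F : kdiff k (fun F => a * z F) F = a * kdiff k z F.
Proof. by rewrite /kdiff mulr_sumr; apply: eq_bigr => v _; rewrite mulrCA. Qed.

Lemma kdiffB k z w F :
  kdiff k (fun F => z F - w F) F = kdiff k z F - kdiff k w F.
Proof. by rewrite /kdiff -sumrB; apply: eq_bigr => v _; rewrite mulrBr. Qed.

Lemma kdiff_sum k (I : finType) (P : pred I) (z : I -> {set V} -> R) F :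
  kdiff k (fun F => \sum_(i | P i) z i F) F = \sum_(i | P i) kdiff k (z i) F.
Proof.
rewrite /kdiff exchange_big; apply: eq_bigr => v _ /=.
by rewrite mulr_sumr.
Qed.

Lemma kdiff_set0 k z F : #|F| = 0%N -> kdiff k z F = 0.
Proof. by move/cards0_eq->; rewrite /kdiff big_set0. Qed.

Lemma kdiff_shift k l w F :
  kdiff (k + l) (fun F => xprod F ^+ l * w F) F = xprod F ^+ l * kdiff k w F.
Proof.
rewrite /kdiff mulr_sumr; apply: eq_bigr => v vF.
by rewrite /xprod [in RHS](big_setD1 v) //= exprD exprMn; ring.
Qed.

Lemma kdiff_mem (J : R -> Prop) k i w : is_ideal J ->
  (forall F, #|F| = i -> J (w F)) -> forall F, #|F| = i.+1 -> J (kdiff k w F).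
Proof.
move=> iJ Jw F Fi; apply: ideal_sum => // v vF.
case: (iJ) => _ _; apply; apply: Jw.
by move: Fi; rewrite (cardsD1 v) vF add1n => -[].
Qed.

(** Vanishing of the local cohomology of R / J in degrees below r.  Local
    cohomology is the direct limit over k of the Koszul cohomology of the
    elements x_v ^ k, with transition maps that multiply the coefficient at F
    by [xprod F ^+ l]; only the values on sets with i elements matter in
    degree i. *)
Definition lc_vanish (J : R -> Prop) (r : nat) : Prop :=
  forall i k z, (i < r)%N ->
    (forall F, #|F| = i.+1 -> J (kdiff k z F)) ->
  exists l w, forall F, #|F| = i ->
    J (xprod F ^+ l * z F - kdiff (k + l) w F).

Definition power_ideal k (f : R) :=
  exists a : V -> R, f = \sum_v a v * x v ^+ k.

Lemma power_ideal_ideal k : is_ideal (power_ideal k).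
Proof.
split=> [|p g [a ->] [b ->]|p g [a ->]].
- by exists (fun=> 0); rewrite big1 // => v _; rewrite mul0r.
- by exists (fun v => a v + b v); rewrite -big_split; apply: eq_bigr => v _;
    rewrite mulrDl.
- by exists (fun v => p * a v); rewrite mulr_sumr; apply: eq_bigr => v _;
    rewrite mulrA.
Qed.

Lemma power_ideal_radical k f : ideal_gen (fun g => exists v, g = x v) f ->
  exists N, power_ideal k (f ^+ N).
Proof.
have iQ := power_ideal_ideal k; have [Q0 QD QM] := iQ.
apply: (ideal_gen_min (J := fun f => exists N, power_ideal k (f ^+ N))).
  split; first by exists 1%N; rewrite expr1.
  - move=> p g [N QN] [M QM']; exists (N + M)%N; rewrite exprDn.
    apply: ideal_sum => // i _; rewrite -mulr_natl; apply: (QM).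
    have [leMi|ltiM] := leqP M i.
      by rewrite -(subnK leMi) exprD mulrA; apply: (QM).
    rewrite -addnBA ?(ltnW ltiM) // exprD -mulrA mulrC; exact: QM.
  - by move=> p g [N QN]; exists N; rewrite exprMn; apply: QM.
move=> _ [v ->]; exists k; exists (fun u => (u == v)%:R).
by rewrite (bigD1 v) //= eqxx mul1r big1 ?addr0 // => u /negPf ->;
  rewrite mul0r.
Qed.

(** Let f be the first element of the sequence.  A power of f is a combination
    of the x_v ^ k, so it annihilates the class of a cocycle z.  On the other
    hand, f is injective on cohomology in the degrees considered: if f z is
    the coboundary of w, then w is a cocycle modulo (J, f), so by induction w
    is a coboundary plus f u, and z is the coboundary of u.  Each use of the
    induction hypothesis raises the exponent k. *)
Lemma lc_vanish_nzd_seq J fs : is_ideal J ->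
  (forall f, f \in fs -> ideal_gen (fun g => exists v, g = x v) f) ->
  nzd_seq J fs -> lc_vanish J (size fs).
Proof.
elim: fs J => [|f fs IH] J iJ fsm; first by [].
move=> /= [regf regfs] i k z; rewrite ltnS => lei Jz.
have iJf := add_elt_ideal f iJ.
have {}IH : lc_vanish (add_elt J f) (size fs).
  by apply: IH => // g gfs; apply: fsm; rewrite inE gfs orbT.
have [J0 JD JM] := iJ.
have step N : forall k z,
    (exists w, forall F, #|F| = i -> J (f ^+ N * z F - kdiff k w F)) ->
    exists l w, forall F, #|F| = i ->
      J (xprod F ^+ l * z F - kdiff (k + l) w F).
  elim: N {k z Jz} => [|N IHN] k z [w Jw].
    by exists 0%N, w => F /Jw; rewrite addn0 !expr0.
  case: i lei Jw IHN => [|i] lei Jw IHN.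
    apply: IHN; exists (fun=> 0) => F F0; rewrite kdiff_set0 // subr0.
    by apply: regf; rewrite mulrA -exprS; have := Jw F F0;
      rewrite kdiff_set0 ?subr0.
  have [||l [w2 Jw2]] := IH i k w => //.
    move=> F Fi; exists (f ^+ N * z F).
    by rewrite mulrA -exprS; have := ideal_opp iJ (Jw F Fi); rewrite opprB.
  have /fin_all_exists[g Jg] : forall F, exists b, #|F| = i ->
      J (xprod F ^+ l * w F - kdiff (k + l) w2 F - f * b).
    move=> F; case: (eqVneq #|F| i) => [Fi|/eqP ne]; last by exists 0.
    by have [b Jb] := Jw2 F Fi; exists b.
  have [|l2 [w3 Jw3]] := IHN (k + l)%N (fun F => xprod F ^+ l * z F).
    exists g => F Fi; apply: regf.
    have := kdiff_mem (k + l) iJ Jg Fi.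
    rewrite !kdiffB kdiffM kdiff_kdiff subr0 kdiff_shift => Jd.
    have -> : f * (f ^+ N * (xprod F ^+ l * z F) - kdiff (k + l) g F) =
       xprod F ^+ l * (f ^+ N.+1 * z F - kdiff k w F) +
       (xprod F ^+ l * kdiff k w F - f * kdiff (k + l) g F) by rewrite exprS;
         ring.
    by apply: JD => //; apply: JM; apply: Jw.
  exists (l + l2)%N, w3 => F Fi.
  have -> : xprod F ^+ (l + l2) * z F = xprod F ^+ l2 * (xprod F ^+ l * z F).
    by rewrite exprD; ring.
  by rewrite addnA; apply: Jw3.
have [N [a fN]] := power_ideal_radical k (fsm f (mem_head _ _)).
apply: (step N); exists (fun F => \sum_v a v * contract v z F) => F Fi.
rewrite fN kdiff_sum mulr_suml -sumrB; apply: ideal_sum => // v _.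
rewrite kdiffM -mulrA -contract_homotopy mulrDr addrC addKr.
apply: (JM); rewrite /contract; case: ifP => // vF.
by apply: (JM); apply: Jz; rewrite cardsU1 vF Fi.
Qed.

End Koszul.

(** * Upper bounds from cohomology classes *)

Lemma mcoeff_sign (K : fieldType) q i (p : {mpoly K[q]}) m :
  ((-1) ^+ i * p)@_m = (-1) ^+ i * p@_m.
Proof.
rewrite -[in LHS]signr_odd -[in RHS]signr_odd.
by case: (odd i); rewrite ?expr1 ?expr0 ?mulN1r ?mul1r ?mcoeffN.
Qed.

Definition sel (T : Type) (a b : nat -> T) (c : bool) (j : nat) : T :=
  if c then b j else a j.

(** The product over j < D of the sums of the vertices labelled j by [B]
    (labels from D on mark the vertices outside all blocks) is a cocycle of
    independent sets by [bc_dom].  The pairs a j, b j span a cross-polytope of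
    independent sets, and by the last two fields a is the only choice in it
    that meets every block exactly once.  Both the blocks and the pairs are
    consecutive for [rk], so that exchanging elements of one block or of one
    pair does not change the other signs. *)
Record block_cert (T : finType) (e : rel T) (rk B : T -> nat) (D : nat)
    (a b : nat -> T) : Prop := BlockCert {
  bc_rk_inj : injective rk;
  bc_rk_block : forall u v, (B u < B v)%N -> (B v < D)%N -> (rk u < rk v)%N;
  bc_dom : forall (F : {set T}) v,
    (forall j, (j < D)%N -> exists2 u, u \in F & B u = j) ->
    indep e F -> (D <= B v)%N -> exists2 u, u \in F & e u v;
  bc_rk_sel : forall c d i j, (i < j)%N -> (j < D)%N ->
    (rk (sel a b c i) < rk (sel a b d j))%N;
  bc_sel_indep : forall c d i j, (i < j)%N -> (j < D)%N ->
    ~~ e (sel a b c i) (sel a b d j);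
  bc_block_a : forall j, (j < D)%N -> B (a j) = j;
  bc_block_b : forall j, (j < D)%N -> (B (b j) < D)%N -> (B (b j) < j)%N }.

Section UpperBound.
Variables (K : fieldType) (q : nat) (G : sgraph 'I_q).
Implicit Types (p g : {mpoly K[q]}) (F A : {set 'I_q}) (u v : 'I_q).

Local Notation X := (fun v : 'I_q => 'X_v : {mpoly K[q]}).
Local Notation J := (sr_ideal (K := K) G setT).

Definition xpow F l : 'X_{1..q} := (mesym1 F *+ l)%MM.

Lemma xpowE F l v : xpow F l v = ((v \in F) * l)%N.
Proof. by rewrite /xpow mulmnE mnmE. Qed.

Lemma xprodX F l : xprod X F ^+ l = 'X_[xpow F l].
Proof. by rewrite /xprod prod_varE mpolyXn. Qed.

Lemma supp_xpow F l : supp (xpow F l.+1) = F.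
Proof.
by apply/setP => v; rewrite !inE xpowE muln_eq0 orbF; case: (v \in F).
Qed.

Lemma varX v l : 'X_v ^+ l = 'X_[xpow [set v] l] :> {mpoly K[q]}.
Proof. by rewrite -xprodX /xprod big_set1. Qed.

Lemma xpow_set1_le v e F l : (xpow [set v] e <= xpow F l)%MM =
  (e == 0%N) || (v \in F) && (e <= l)%N.
Proof.
apply/mnm_lepP/idP => [/(_ v)|].
  by rewrite !xpowE inE eqxx mul1n; case: (v \in F);
    rewrite ?mul1n ?mul0n ?leqn0 => ->; rewrite ?orbT.
case/orP => [/eqP -> u|/andP[vF le_el] u]; first by rewrite !xpowE muln0.
by rewrite !xpowE inE; case: eqP => // ->; rewrite vF !mul1n.
Qed.

Lemma mcoeff_kdiff rk k (w : {set 'I_q} -> {mpoly K[q]}) F l :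
  (kdiff rk X k.+1 w F)@_(xpow F l) =
  if (k < l)%N then \sum_(v in F) (-1) ^+ #|[set u in F | rk u < rk v]%N| *
      (w (F :\ v))@_(xpow F l - xpow [set v] k.+1)%MM else 0.
Proof.
have E v : v \in F -> (ksign _ rk v F * 'X_v ^+ k.+1 * w (F :\ v))@_(xpow F l) =
    if (k < l)%N then (-1) ^+ #|[set u in F | rk u < rk v]%N| *
      (w (F :\ v))@_(xpow F l - xpow [set v] k.+1)%MM else 0.
  move=> vF; rewrite /ksign -mulrA mcoeff_sign varX [_ * w _]mulrC mcoeffMX_if.
  by rewrite xpow_set1_le vF /=; case: ifP => //; rewrite mulr0.
rewrite raddf_sum /= (eq_bigr _ E).
by case: ifP => // _; rewrite big1.
Qed.

Lemma edge_mem u v p g : G u v -> J (p * 'X_u * ('X_v * g)).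
Proof.
move=> uv; have -> : p * 'X_u * ('X_v * g) = (p * g) * ('X_u * 'X_v) by ring.
case: (sr_ideal_ideal K G setT) => _ _; apply; apply/edge_idealE.
by apply: mem_ideal_gen; exists u, v.
Qed.

Lemma lc_vanish_of_regular_seq (rk : 'I_q -> nat) fs : injective rk ->
  regular_seq (@graded_max_ideal K q) (edge_ideal G) fs ->
  lc_vanish rk X J (size fs).
Proof.
move=> rk_inj [fsm reg _]; apply: lc_vanish_nzd_seq => //.
  exact: sr_ideal_ideal.
have iI : is_ideal (@edge_ideal K q G) by apply: ideal_gen_ideal.
by move/(nzd_seqP _ iI): reg; apply: nzd_seq_ext => p; apply: edge_idealE.
Qed.

(** The cochain with value [xprod A] at A and 0 elsewhere is a cocycle for the
    squares of the variables, since every vertex outside A has a neighbour in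
    A.  It never becomes a coboundary: the power of [xprod A] in question has
    exponents smaller than the power of x_v in each term of a coboundary. *)
Theorem regular_seq_le_facet A fs : indep G A ->
  (forall v, v \notin A -> exists2 u, u \in A & G u v) ->
  regular_seq (@graded_max_ideal K q) (edge_ideal G) fs -> (size fs <= #|A|)%N.
Proof.
move=> iA domA reg; rewrite leqNgt; apply/negP => ltA.
have rk_inj : injective (fun v : 'I_q => v : nat) by apply: val_inj.
pose z F : {mpoly K[q]} := (F == A)%:R * xprod X A.
have [|l [w Jw]] := lc_vanish_of_regular_seq rk_inj reg (k := 2) (z := z) ltA.
  move=> F FA; apply: ideal_sum => [|v vF]; first exact: sr_ideal_ideal.
  rewrite /z; case: eqP => [defA|_]; last by rewrite mul0r mulr0;
    case: (sr_ideal_ideal K G setT).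
  have vA : v \notin A by rewrite -defA !inE eqxx.
  have [u uA uv] := domA v vA.
  rewrite mul1r /xprod (big_setD1 u) //= expr2 mulrA.
  by apply: edge_mem; rewrite edge_sym.
have := Jw A erefl (xpow A l.+1) (subsetT _).
rewrite supp_xpow => /(_ iA);
  rewrite /z eqxx mul1r -exprSr xprodX mcoeffB mcoeffX eqxx.
rewrite -[(2 + l)%N]/l.+2 mcoeff_kdiff ltnn subr0 => /eqP; exact/negP/oner_neq0.
Qed.

Section Blocks.
Variables (rk B : 'I_q -> nat) (D : nat) (a b : nat -> 'I_q).

Definition transversal F : bool :=
  [&& #|F| == D, [forall u in F, (B u < D)%N] &
      [forall u in F, [forall v in F, (B u == B v) ==> (u == v)]]].

Lemma transversalP F : reflect
  [/\ #|F| = D, forall u, u \in F -> (B u < D)%N & {in F &, injective B}]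
  (transversal F).
Proof.
apply: (iffP and3P) =>
    [[/eqP FD /forall_inP ltB /forall_inP injB]|[FD ltB injB]].
  split=> // u v uF vF Buv; have /forall_inP /(_ v vF) := injB u uF.
  by rewrite Buv eqxx => /eqP.
split; [exact/eqP|exact/forall_inP|].
apply/forall_inP => u uF; apply/forall_inP => v vF; apply/implyP => /eqP Buv.
by apply/eqP; apply: injB.
Qed.

Hypothesis cert : block_cert G rk B D a b.
Let rk_inj := bc_rk_inj cert.
Let rk_block := bc_rk_block cert.
Let dom := bc_dom cert.
Let rk_sel := bc_rk_sel cert.
Let sel_indep := bc_sel_indep cert.
Let B_a := bc_block_a cert.
Let B_b := bc_block_b cert.

Lemma card_block_inj F : (forall u, u \in F -> (B u < D)%N) ->
  {in F &, injective B} -> (#|F| <= D)%N.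
Proof.
move=> ltB injB; rewrite cardE -(size_map B) -[X in (_ <= X)%N](size_iota 0).
apply: uniq_leq_size.
  by rewrite map_inj_in_uniq ?enum_uniq // => u v; rewrite !mem_enum;
    apply: injB.
by move=> _ /mapP[u uF ->]; rewrite mem_iota; apply: ltB; rewrite -mem_enum.
Qed.

Lemma transversal_hits F j : transversal F -> (j < D)%N ->
  exists2 u, u \in F & B u = j.
Proof.
move=> /transversalP[FD ltB injB] ltj.
have uB : uniq [seq B u | u <- enum F].
  by rewrite map_inj_in_uniq ?enum_uniq // => u v; rewrite !mem_enum;
    apply: injB.
have sB : {subset [seq B u | u <- enum F] <= iota 0 D}.
  by move=> _ /mapP[u uF ->]; rewrite mem_iota ltB // -mem_enum.
have [|_ E] := uniq_min_size uB sB;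
  first by rewrite size_iota size_map -cardE FD.
have : j \in iota 0 D by rewrite mem_iota.
by rewrite -E => /mapP[u]; rewrite mem_enum => uF ->; exists u.
Qed.

Lemma ksign_same_block u v F : u \in F -> v \in F -> B u = B v ->
  (forall w, w \in F -> (B w < D)%N) ->
  (forall w, w \in F -> w != u -> w != v -> B w != B v) -> (rk u < rk v)%N ->
  [set w in F | (rk w < rk v)%N] = u |: [set w in F | (rk w < rk u)%N].
Proof.
move=> uF vF Buv ltB_mem other ltuv; have ltB := ltB_mem v vF;
  apply/setP => w; rewrite !inE.
case: (eqVneq w u) => [->|wu] /=; first by rewrite uF.
case: (eqVneq w v) => [->|wv];
  first by rewrite ltnn [(_ < rk u)%N]ltnNge ltnW ?andbF.
case: (boolP (w \in F)) => //= wF;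
  case: (ltngtP (B w) (B v)) (other w wF wu wv) => // ltw _.
  by rewrite (rk_block ltw ltB) (@rk_block w u) ?Buv.
have vw := rk_block ltw (ltB_mem w wF).
have uw : (rk u < rk w)%N by apply: rk_block; rewrite ?Buv ?ltB_mem.
by rewrite ltnNge (ltnW vw) ltnNge (ltnW uw).
Qed.

Lemma ksign_sum_same_block u v F : u \in F -> v \in F -> u != v -> B u = B v ->
  (forall w, w \in F -> (B w < D)%N) ->
  (forall w, w \in F -> w != u -> w != v -> B w != B v) ->
  ksign {mpoly K[q]} rk u F + ksign {mpoly K[q]} rk v F = 0.
Proof.
wlog ltuv : u v / (rk u < rk v)%N => [H|] uF vF uv Buv ltB other.
  have : rk u != rk v by apply: contra uv => /eqP/rk_inj ->.
  rewrite neq_ltn => /orP[lt|lt]; first exact: H.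
  rewrite addrC; apply: H => //; first by rewrite eq_sym.
  by move=> w wF wv wu; rewrite Buv; apply: other.
rewrite /ksign (ksign_same_block uF vF) // cardsU1 !inE ltnn andbF /=.
by rewrite add1n exprS mulN1r addrN.
Qed.

(** If F minus v is a transversal, the block of v contains exactly one other
    element of F, and the two corresponding terms cancel; for v outside all
    blocks, F would not be independent. *)
Lemma transversal_cocycle F : #|F| = D.+1 -> indep G F ->
  \sum_(v in F) ksign {mpoly K[q]} rk v F * (transversal (F :\ v))%:R = 0.
Proof.
move=> FD iF; case: (boolP [exists v in F, transversal (F :\ v)]); last first.
  move=> /exists_inPn nt; apply: big1 => v vF.
  by rewrite (negPf (nt v vF)) mulr0.
case/exists_inP => v vF tv; have /transversalP[_ ltBv injBv] := tv.
have iFv : indep G (F :\ v) by apply: indepS iF; apply: subsetDl.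
have ltBvD : (B v < D)%N.
  rewrite ltnNge; apply/negP => /(dom (fun j => transversal_hits tv) iFv)[u];
    rewrite !inE => /andP[_ uF].
  by apply/negP; apply: (indepP _ _ iF).
have ltB u : u \in F -> (B u < D)%N.
  by move=> uF; case: (eqVneq u v) => [->|uv] //; apply: ltBv; rewrite !inE uv.
have [u uF /andP[uv /eqP Buv]] : exists2 u, u \in F & (u != v) && (B u == B v).
  apply/exists_inP; apply: contraTT isT => /exists_inPn noB.
  suff : (#|F| <= D)%N by rewrite FD ltnn.
  apply: card_block_inj => // u w uF wF Buw.
  have nB y : y \in F -> y != v -> B y != B v.
    by move=> yF yv; have := noB y yF; rewrite yv.
  case: (eqVneq u v) => [uv|uv]; case: (eqVneq w v) => [wv|wv].
  - by rewrite uv wv.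
  - by case/eqP: (nB w wF wv); rewrite -Buw uv.
  - by case/eqP: (nB u uF uv); rewrite Buw wv.
  - by apply: injBv; rewrite ?inE ?uv ?wv.
have other w : w \in F -> w != u -> w != v -> B w != B v.
  move=> wF wu wv; rewrite -Buv; apply: contra wu => /eqP Bwu.
  by apply/eqP; apply: injBv; rewrite ?inE ?uv ?wv.
have tu : transversal (F :\ u).
  apply/transversalP; split.
  - by move: FD; rewrite (cardsD1 u) uF add1n => -[].
  - by move=> w; rewrite !inE => /andP[_ /ltB].
  - move=> w y; rewrite !inE => /andP[wu wF] /andP[yu yF] Bwy.
    case: (eqVneq w v) => [wv|wv]; case: (eqVneq y v) => [yv|yv].
    + by rewrite wv yv.
    + by case/eqP: (other y yF yu yv); rewrite -Bwy wv.
    + by case/eqP: (other w wF wu wv); rewrite Bwy yv.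
    + by apply: injBv; rewrite ?inE ?wv ?yv.
rewrite (bigD1 v) //= (bigD1 u) ?uF //= tv tu !mulr1 big1 => [|w].
  rewrite addr0 addrC; exact: ksign_sum_same_block.
move=> /andP[/andP[wF wv] wu]; suff /negPf -> : ~~ transversal (F :\ w).
  by rewrite mulr0.
apply/negP => /transversalP[_ _ injw]; case/eqP: uv; apply: injw => //.
  by rewrite !inE uF eq_sym wu.
by rewrite !inE vF eq_sym wv.
Qed.

Definition selection (c : {ffun 'I_D -> bool}) (j : 'I_D) : 'I_q :=
  sel a b (c j) j.

Definition selection_set (c : {ffun 'I_D -> bool}) : {set 'I_q} :=
  [set selection c j | j : 'I_D].

Lemma rk_selection c i j :
  (rk (selection c i) < rk (selection c j))%N = (i < j)%N.
Proof.
case: (ltngtP i j) => [lt|lt|/val_inj ->]; last exact: ltnn.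
  exact: rk_sel.
by apply/negP => /ltnW; rewrite leqNgt rk_sel.
Qed.

Lemma selection_inj c : injective (selection c).
Proof.
by move=> i j eq; apply: val_inj; case: (ltngtP i j) => //;
  rewrite -(rk_selection c) eq ltnn.
Qed.

Lemma card_selection_set c : #|selection_set c| = D.
Proof. by rewrite card_imset ?card_ord //; apply: selection_inj. Qed.

Lemma selection_set_indep c : indep G (selection_set c).
Proof.
apply/indepP => _ _ /imsetP[i _ ->] /imsetP[j _ ->].
case: (ltngtP i j) => [lt|lt|/val_inj ->]; last by rewrite edge_irr.
  exact: sel_indep.
by rewrite edge_sym; apply: sel_indep.
Qed.

Lemma selection_rank c (j : 'I_D) :
  #|[set u in selection_set c | (rk u < rk (selection c j))%N]| = j.
Proof.
have -> : [set u in selection_set c | (rk u < rk (selection c j))%N] =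
    selection c @: [set i : 'I_D | (i < j)%N].
  apply/setP => u; rewrite !inE; apply/andP/imsetP.
    by case=> /imsetP[i _ ->]; rewrite rk_selection => lt; exists i;
      rewrite ?inE.
  by case=> i; rewrite inE => lt ->; rewrite rk_selection lt imset_f.
rewrite card_imset; last exact: selection_inj.
rewrite -sum1_card (eq_bigl (fun i : 'I_D => (i < j)%N)); last by move=> i;
  rewrite inE.
by rewrite -(big_ord_widen D (fun=> 1%N) (ltnW (ltn_ord j))) sum1_card card_ord.
Qed.

(** The labels of the selected vertices are at most their indices; if they are
    also distinct and below D, they equal the indices. *)
Lemma selection_set_transversal c :
  transversal (selection_set c) = (c == [ffun=> false]).
Proof.
apply/transversalP/eqP => [[_ ltB injB]|->].
  apply/ffunP => j; rewrite ffunE; apply/negP => cj.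
  have [k] := ubnP (j : nat); elim: k j cj => // k IH j cj;
    rewrite ltnS => lejk.
  have jF : selection c j \in selection_set c by apply: imset_f.
  have := ltB _ jF; rewrite /selection /sel cj => ltBb.
  have ltj := B_b (ltn_ord j) ltBb.
  pose i : 'I_D := Ordinal ltBb.
  case: (boolP (c i)) => ci; first by apply: (IH i ci); apply: leq_trans lejk.
  have iF : selection c i \in selection_set c by apply: imset_f.
  have Bij : B (selection c i) = B (selection c j).
    by rewrite /selection /sel (negPf ci) cj B_a.
  have /selection_inj ij := injB _ _ iF jF Bij.
  by rewrite ij cj in ci.
have chE j : selection [ffun=> false] j = a j by rewrite /selection ffunE.
split; first exact: card_selection_set.
  by move=> _ /imsetP[j _ ->]; rewrite chE B_a.
by move=> _ _ /imsetP[i _ ->] /imsetP[j _ ->];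
  rewrite !chE !B_a // => /val_inj ->.
Qed.

(** The signed sum of the sets selecting one element of each pair is a cycle:
    removing the element of the j-th pair leaves a set that occurs twice, with
    opposite signs. *)
Lemma cross_polytope_cycle (f : {set 'I_q} -> K) :
  \sum_(c : {ffun 'I_D -> bool}) (-1) ^+ #|[set j | c j]| *
    (\sum_(v in selection_set c)
      (-1) ^+ #|[set u in selection_set c | (rk u < rk v)%N]| *
        f (selection_set c :\ v))
  = 0.
Proof.
pose flip (j : 'I_D) (c : {ffun 'I_D -> bool}) := [ffun i => (i == j) (+) c i].
have flipK j : involutive (flip j).
  by move=> c; apply/ffunP => i; rewrite !ffunE addbA addbb.
have E c : (\sum_(v in selection_set c)
      (-1) ^+ #|[set u in selection_set c | (rk u < rk v)%N]| *
        f (selection_set c :\ v))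
    = \sum_(j < D) (-1) ^+ j * f (selection_set c :\ selection c j).
  rewrite big_imset /=; last by move=> i j _ _; apply: selection_inj.
  by apply: eq_bigr => j _; rewrite selection_rank.
under eq_bigr => c _ do rewrite E mulr_sumr.
rewrite exchange_big big1 //= => j _.
rewrite (bigID (fun c : {ffun 'I_D -> bool} => c j)) /=.
rewrite [X in X + _](reindex_inj (inv_inj (flipK j))) /=.
rewrite (eq_bigl (fun c : {ffun 'I_D -> bool} => ~~ c j)); last first.
  by move=> c; rewrite ffunE eqxx.
rewrite -big_split big1 //= => c ncj.
have -> : [set i | flip j c i] = j |: [set i | c i].
  apply/setP => i; rewrite !inE ffunE.
  by case: (eqVneq i j) => [->|] //=; rewrite ncj.
rewrite cardsU1 inE ncj /= add1n exprS.
have chE i : i != j -> selection (flip j c) i = selection c i.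
  by move=> ij; rewrite /selection ffunE (negPf ij).
have -> : selection_set (flip j c) :\ selection (flip j c) j =
  selection_set c :\ selection c j.
  apply/setP => u; rewrite !inE; apply/andP/andP.
    case=> nu /imsetP[i _ def_u];
      have ij : i != j by apply: contraNneq nu => ij; rewrite def_u ij.
    by rewrite def_u chE // (inj_eq (@selection_inj c)) ij imset_f.
  case=> nu /imsetP[i _ def_u];
    have ij : i != j by apply: contraNneq nu => ij; rewrite def_u ij.
  by rewrite def_u -chE // (inj_eq (@selection_inj _)) ij imset_f.
by ring.
Qed.

(** The coefficients at suitable powers of [xprod F] turn a bounding cochain
    into a function whose coboundary is the indicator of the transversals;
    evaluated on the cross-polytope, the latter is 1 or -1 and the former 0. *)
Theorem regular_seq_le_blocks fs :
  regular_seq (@graded_max_ideal K q) (edge_ideal G) fs -> (size fs <= D)%N.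
Proof.
move=> reg; rewrite leqNgt; apply/negP => ltD.
have iJ := sr_ideal_ideal K G setT; have [J0 _ JM] := iJ.
pose z F : {mpoly K[q]} := (transversal F)%:R * xprod X F.
have [|l [w Jw]] := lc_vanish_of_regular_seq rk_inj reg (k := 1) (z := z) ltD.
  move=> F FD.
  have -> : kdiff rk X 1 z F = xprod X F *
      \sum_(v in F) ksign {mpoly K[q]} rk v F * (transversal (F :\ v))%:R.
    rewrite mulr_sumr; apply: eq_bigr => v vF.
    by rewrite /z {2}/xprod (big_setD1 v) //=; rewrite expr1 /xprod; ring.
  case: (boolP (indep G F)) => iF;
    first by rewrite transversal_cocycle // mulr0.
  rewrite mulrC; apply: JM.
  move: iF; rewrite negb_forall_in => /exists_inP[u uF].
  rewrite negb_forall_in => /exists_inP[v vF]; rewrite negbK => uv.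
  have vu : v \in F :\ u.
    by rewrite !inE vF andbT; apply: contraTneq uv => ->; rewrite edge_irr.
  rewrite /xprod (big_setD1 u) //= (big_setD1 v) //= -[X u]mul1r.
  exact: edge_mem.
pose f F := (w F)@_(xpow F l.+1).
have coef F : #|F| = D -> indep G F -> (transversal F)%:R =
    \sum_(v in F) (-1) ^+ #|[set u in F | (rk u < rk v)%N]| * f (F :\ v) :> K.
  move=> FD iF; have := Jw F FD (xpow F l.+1) (subsetT _).
  rewrite supp_xpow => /(_ iF); rewrite /z mulrCA -exprSr xprodX mcoeffB.
  rewrite mulr_natl mcoeffMn mcoeffX eqxx -[(1 + l)%N]/l.+1 mcoeff_kdiff ltnSn.
  move/eqP; rewrite subr_eq0 => /eqP ->; apply: eq_bigr => v vF.
  congr (_ * (w _)@_ _); apply/mnmP => u; rewrite mnmBE !xpowE !inE.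
  by case: (eqVneq u v) => [->|] /=; rewrite ?vF ?subnn ?mul0n ?subn0.
have := cross_polytope_cycle f.
under eq_bigr => c _ do
  rewrite -coef ?card_selection_set ?selection_set_indep //
    selection_set_transversal.
rewrite (bigD1 [ffun=> false]) //= big1 => [|c /negPf ->];
  last by rewrite mulr0.
by rewrite eqxx mulr1 addr0 => /eqP; rewrite signr_eq0.
Qed.

End Blocks.
End UpperBound.

(** * Branching on open ladders *)

Section Combinatorics.
Local Open Scope nat_scope.

Section SheddingTheory.
Variables (T : finType) (e : rel T).
Hypotheses (e_sym : ssrbool.symmetric e) (e_irr : irreflexive e).
Implicit Types (U W : {set T}).

Lemma shedding_le U d d' : d' <= d -> shedding e U d -> shedding e U d'.
Proof.
move=> le_d sU; elim: sU le_d => {U d} [U d iU dU|U d v vU _ IH1 _ IH2] le_d.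
  by apply: shedding_indep => //; apply: leq_trans dU.
by apply: shedding_split vU _ _; [apply: IH1|apply: IH2].
Qed.

Definition separated U W :=
  forall u w, u \in U -> w \in W -> (u != w) && ~~ e u w.

Lemma separatedC U W : separated U W -> separated W U.
Proof. by move=> sep w u wW uU; rewrite eq_sym e_sym; apply: sep. Qed.

Lemma separatedS U U' W : U' \subset U -> separated U W -> separated U' W.
Proof. by move=> /subsetP sU sep u w /sU uU; apply: sep. Qed.

Lemma shedding_indepU U W d : indep e U -> separated U W ->
  shedding e W d -> shedding e (U :|: W) (#|U| + d).
Proof.
move=> iU sep sW; elim: sW sep => {W d} [W d iW dW|W d w wW _ IH1 _ IH2] sep.
  have dUW : U :&: W = set0.
    apply/setP => u; rewrite !inE; apply/negP => /andP[uU uW].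
    by have := sep u u uU uW; rewrite eqxx.
  apply: shedding_indep; last by rewrite cardsU dUW cards0 subn0 leq_add2l.
  apply/indepP => u v; rewrite !inE => /orP[uU|uW] /orP[vU|vW].
  - exact: (indepP _ _ iU).
  - by have /andP[] := sep u v uU vW.
  - by rewrite e_sym; have /andP[] := sep v u vU uW.
  - exact: (indepP _ _ iW).
have sepS W' : W' \subset W -> separated U W'.
  by move=> sW; apply/separatedC/(separatedS sW)/separatedC.
apply: (@shedding_split _ _ _ _ w); first by rewrite !inE wW orbT.
  have -> : (U :|: W) :\ w = U :|: (W :\ w).
    apply/setP => u; rewrite !inE; case: (boolP (u \in U)) => uU;
      rewrite ?andbT //=.
    by have /andP[->] := sep u w uU wW.
  by apply/IH1/sepS/subsetDl.
have -> : (U :|: W) :\: nbhd e w = U :|: (W :\: nbhd e w).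
  apply/setP => u; rewrite !inE; case: (boolP (u \in U)) => uU;
    rewrite ?andbT //=.
  by have /andP[_] := sep u w uU wW; rewrite e_sym => ->.
by apply/IH2/sepS/subsetDl.
Qed.

Lemma shedding_union U W d d' : separated U W ->
  shedding e U d -> shedding e W d' -> shedding e (U :|: W) (d + d').
Proof.
move=> sep sU sW; elim: sU sep => {U d} [U d iU dU|U d u uU _ IH1 _ IH2] sep.
  apply: (@shedding_le _ (#|U| + d')); first by rewrite leq_add2r.
  exact: shedding_indepU.
apply: (@shedding_split _ _ _ _ u); first by rewrite !inE uU.
  have -> : (U :|: W) :\ u = (U :\ u) :|: W.
    apply/setP => w; rewrite !inE; case: (boolP (w \in W)) => wW;
      rewrite ?orbT ?orbF //=.
    by rewrite andbT eq_sym; have /andP[->] := sep u w uU wW.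
  by apply/IH1/(separatedS _ sep)/subsetDl.
have -> : (U :|: W) :\: nbhd e u = (U :\: nbhd e u) :|: W.
  apply/setP => w; rewrite !inE; case: (boolP (w \in W)) => wW;
    rewrite ?orbT ?orbF //=.
  by rewrite andbT; have /andP[_ ->] := sep u w uU wW.
by apply/IH2/(separatedS _ sep)/subsetDl.
Qed.

End SheddingTheory.

Lemma shedding_imset (T T' : finType) (e : rel T) (e' : rel T') (f : T -> T')
    (U : {set T}) d :
  injective f -> (forall x y, e' (f x) (f y) = e x y) ->
  shedding e U d -> shedding e' (f @: U) d.
Proof.
move=> f_inj ef; elim=> {U d} [U d iU dU|U d v vU _ IH1 _ IH2].
  apply: shedding_indep; last by rewrite card_imset.
  apply/indepP => _ _ /imsetP[u uU ->] /imsetP[v vU ->].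
  by rewrite ef; apply: (indepP _ _ iU).
apply: (@shedding_split _ _ _ _ (f v)); first exact: imset_f.
  suff -> : (f @: U) :\ f v = f @: (U :\ v) by [].
  apply/setP => w; rewrite !inE; apply/andP/imsetP.
    by case=> nw /imsetP[u uU defw]; exists u => //;
       rewrite !inE uU andbT -(inj_eq f_inj) -defw.
  by case=> u; rewrite !inE => /andP[nu uU] ->;
    rewrite (inj_eq f_inj) nu imset_f.
suff -> : (f @: U) :\: nbhd e' (f v) = f @: (U :\: nbhd e v) by [].
apply/setP => w; rewrite inE; apply/andP/imsetP.
  case=> nw /imsetP[u uU defw]; exists u => //.
  by rewrite !inE uU andbT; move: nw; rewrite defw inE ef.
case=> u; rewrite !inE => /andP[nu uU] ->.
by rewrite ef imset_f.
Qed.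

Section Strip.
Variables (T : finType) (e : rel T).
Hypotheses (e_sym : ssrbool.symmetric e) (e_irr : irreflexive e).

(** A piece of ladder whose side Z starts one step after the side Y, so that
    Y a is a leaf attached to Z a.+1. *)
Definition strip (Y Z : nat -> T) a b f : {set T} :=
  [set x | [exists i : 'I_b, (a <= i) && (x == Y i)]
        || [exists i : 'I_f, (a < i) && (x == Z i)]].

Lemma stripP Y Z a b f x : reflect
  ((exists2 i, a <= i < b & x = Y i) \/ (exists2 i, a < i < f & x = Z i))
  (x \in strip Y Z a b f).
Proof.
rewrite inE; apply: (iffP orP).
  case=> /existsP[i /andP[ai /eqP ->]]; [left|right]; exists (i : nat) => //;
  by rewrite ai ltn_ord.
case=> -[i /andP[ai ib] ->]; [left|right]; apply/existsP; exists (Ordinal ib);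
by rewrite ai eqxx.
Qed.

Record ladder (Y Z : nat -> T) (lo hi : nat) : Prop := Ladder {
  ladderYZ : forall i j, lo <= i < hi -> lo <= j < hi ->
     e (Y i) (Z j) = (i <= j.+1) && (j <= i.+1);
  ladderYY : forall i j, lo <= i < hi -> lo <= j < hi -> ~~ e (Y i) (Y j);
  ladderZZ : forall i j, lo <= i < hi -> lo <= j < hi -> ~~ e (Z i) (Z j);
  ladderY_inj : forall i j, lo <= i < hi -> lo <= j < hi -> Y i = Y j -> i = j;
  ladderZ_inj : forall i j, lo <= i < hi -> lo <= j < hi -> Z i = Z j -> i = j;
  ladder_neq : forall i j, lo <= i < hi -> lo <= j < hi -> Y i <> Z j }.

Lemma ladderC Y Z lo hi : ladder Y Z lo hi -> ladder Z Y lo hi.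
Proof.
case=> yz yy zz yi zi ne; split=> // i j ri rj; last exact/nesym/ne.
by rewrite e_sym yz // andbC.
Qed.

(** The function with value p for p < 4 that grows by 2 with every 4 steps. *)
Definition four_by_two p := 2 * (p %/ 4) + p %% 4.

(** The cases describe the far end of the strip: the side Z ends one step
    later than Y, at the same step, or one step earlier.  The values solve
    the recursion found in [shedding_strip]. *)
Definition strip_depth p r :=
  if r == p.+1 then four_by_two p
  else if r == p then uphalf p else (four_by_two p.+1).-1.

Lemma strip_depth_del p r : 0 < p -> 1 < r -> p <= r.+1 -> r <= p.+1 ->
  strip_depth p r <= (strip_depth p.-1 r.-1).+1.
Proof.
move=> p0 r1 pr rp; rewrite /strip_depth /four_by_two.
repeat (case: ifP => /eqP ?); lia.
Qed.

Lemma strip_depth_sel p r : 0 < p -> 1 < r -> p <= r.+1 -> r <= p.+1 ->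
  strip_depth p r <= (strip_depth r.-2 p.-2).+1.
Proof.
move=> p0 r1 pr rp; rewrite /strip_depth /four_by_two.
repeat (case: ifP => /eqP ?); lia.
Qed.

(** Branch on Z a.+1.  Deleting it isolates Y a and leaves the strip that
    starts at a.+1.  Selecting it removes Y a, Y a.+1 and Y a.+2, and leaves a
    strip that starts at a.+2 with the two sides exchanged. *)
Lemma shedding_strip lo hi p r a Y Z : ladder Y Z lo hi ->
  p <= r.+1 -> r <= p.+1 -> lo <= a -> a + p <= hi -> a + r <= hi ->
  shedding e (strip Y Z a (a + p) (a + r)) (strip_depth p r).
Proof.
have [s] := ubnP (p + r); elim: s p r a Y Z => // s IH p r a Y Z.
rewrite ltnS => le_s lad pr rp lo_a hi_p hi_r.
case: lad (lad) => yz yy zz yi zi ne lad.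
have [r1|r1] := leqP r 1.
  have stripE x : x \in strip Y Z a (a + p) (a + r) ->
    exists2 i, a <= i < a + p & x = Y i.
    by case/stripP => // -[i]; lia.
  apply: shedding_indep.
    apply/indepP => _ _ /stripE[i ri ->] /stripE[j rj ->]; apply: yy; lia.
  apply: (leq_trans (n := #|[set Y (a + i) | i : 'I_p]|)).
    rewrite card_imset ?card_ord => [|i j /yi E]; last first.
      have ip := ltn_ord i; have jp := ltn_ord j.
      by apply: val_inj => /=; have := E ltac:(lia) ltac:(lia); lia.
    by rewrite /strip_depth /four_by_two; repeat (case: ifP => /eqP ?); lia.
  apply/subset_leq_card/subsetP => _ /imsetP[i _ ->]; apply/stripP; left.
  by exists (a + i) => //; have := ltn_ord i; lia.
have [p0|p0] := posnP p; first by lia.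
have vU : Z a.+1 \in strip Y Z a (a + p) (a + r).
  by apply/stripP; right; exists a.+1 => //; lia.
apply: (shedding_split vU).
  have -> : strip Y Z a (a + p) (a + r) :\ Z a.+1 =
      [set Y a] :|: strip Y Z a.+1 (a.+1 + p.-1) (a.+1 + r.-1).
    have -> : a.+1 + p.-1 = a + p by lia.
    have -> : a.+1 + r.-1 = a + r by lia.
    apply/setP => x; rewrite in_setU1 in_setD1; apply/andP/orP.
      case=> nx /stripP[[i ri defx]|[i ri defx]].
        have [ia|ia] := eqVneq i a; first by left; rewrite defx ia.
        by right; apply/stripP; left; exists i => //; lia.
      right; apply/stripP; right; exists i => //.
      by have : i != a.+1 by [apply: contraNneq nx => <-; rewrite defx]; lia.
    case=> [/eqP ->|/stripP[[i ri ->]|[i ri ->]]].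
    - split; last by apply/stripP; left; exists a => //; lia.
      by apply/eqP; apply: ne; lia.
    - split; last by apply/stripP; left; exists i => //; lia.
      by apply/eqP; apply: ne; lia.
    - split; last by apply/stripP; right; exists i => //; lia.
      by apply/eqP => /zi E; have := E ltac:(lia) ltac:(lia); lia.
  apply: (shedding_le (d := 1 + strip_depth p.-1 r.-1)).
    by rewrite add1n strip_depth_del.
  rewrite -[1](cards1 (Y a)); apply: (shedding_indepU e_sym).
  - by apply/indepP => u v /set1P-> /set1P->; rewrite e_irr.
  - move=> u w /set1P-> /stripP[[i ri ->]|[i ri ->]]; apply/andP; split.
    + by apply/eqP => /yi E; have := E ltac:(lia) ltac:(lia); lia.
    + by apply: yy; lia.
    + by apply/eqP; apply: ne; lia.
    + by rewrite yz; lia.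
  - by apply: IH; try lia.
have -> : strip Y Z a (a + p) (a + r) :\: nbhd e (Z a.+1) =
    [set Z a.+1] :|: strip Z Y a.+2 (a.+2 + r.-2) (a.+2 + p.-2).
  apply/setP => x; rewrite in_setU1 in_setD inE; apply/andP/orP.
    case=> nx /stripP[[i ri defx]|[i ri defx]].
      right; apply/stripP; right; exists i => //.
      by move: nx; rewrite defx e_sym yz; lia.
    have [ia|ia] := eqVneq i a.+1; first by left; rewrite defx ia.
    by right; apply/stripP; left; exists i => //; lia.
  case=> [/eqP ->|/stripP[[i ri ->]|[i ri ->]]].
  - by split=> //; rewrite e_irr.
  - by split; [apply: zz; lia|apply/stripP; right; exists i => //; lia].
  - by split; [rewrite e_sym yz; lia|apply/stripP; left; exists i => //; lia].
apply: (shedding_le (d := 1 + strip_depth r.-2 p.-2)).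
  by rewrite add1n strip_depth_sel.
rewrite -[1](cards1 (Z a.+1)); apply: (shedding_indepU e_sym).
- by apply/indepP => u v /set1P-> /set1P->; rewrite e_irr.
- move=> u w /set1P-> /stripP[[i ri ->]|[i ri ->]]; apply/andP; split.
  + by apply/eqP => /zi E; have := E ltac:(lia) ltac:(lia); lia.
  + by apply: zz; lia.
  + by apply/eqP => /esym; apply: ne; lia.
  + by rewrite e_sym yz; lia.
- by apply: IH; try lia; apply: ladderC.
Qed.

End Strip.

(** * Branching on circular ladders *)

Section CircularLadder.
Variables (m0 : nat) (sw : bool).
Local Notation m := m0.+2.
Local Notation T := ('I_m * bool)%type.
Implicit Types (u v x : T).

(** The vertices (k, false) and (k, true) are y_k and z_k.  The flag [sw] tells
    whether the rows are exchanged between the last column and column 0; the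
    number of columns is at least two. *)
Definition cladder : rel T := fun u v =>
  [&& u.2 != v.2, u.1 <= v.1.+1 & v.1 <= u.1.+1] ||
  ((u.1 == 0 :> nat) && (v.1 == m0.+1 :> nat) ||
   (v.1 == 0 :> nat) && (u.1 == m0.+1 :> nat)) && ((u.2 != v.2) (+) sw).

Lemma cladder_sym : ssrbool.symmetric cladder.
Proof.
by move=> [i b] [j c]; rewrite /cladder /=; case: b; case: c; case: sw => /=;
  lia.
Qed.

Lemma cladder_irr : irreflexive cladder.
Proof. by move=> [i b]; rewrite /cladder /= eqxx /=; lia. Qed.

(** The index m stands for column 0 reached from the last column. *)
Definition track (b : bool) (i : nat) : T :=
  if i < m then (inord i, b) else (ord0, b (+) sw).

Lemma trackE b i : i <= m ->
  ((track b i).1 = (if i < m then i else 0) :> nat) *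
  ((track b i).2 = if i < m then b else b (+) sw).
Proof. by move=> lei; rewrite /track; case: ifP => lt //=; rewrite inordK. Qed.

Lemma track_eqE u b i : i <= m -> (u == track b i) =
  (u.1 == (if i < m then i else 0) :> nat) &&
    (u.2 == if i < m then b else b (+) sw).
Proof.
move=> lei; rewrite -pair_eqE /pair_eq /= -val_eqE /=.
by rewrite !trackE.
Qed.

(** A window that is too short to go around the cycle is an open ladder. *)
Lemma cladder_track lo hi : 0 < lo -> hi <= m.+1 -> hi <= lo + m.-1 ->
  ladder cladder (track false) (track true) lo hi.
Proof.
move=> lo0 him hilo.
have eE b b' i j : lo <= i < hi -> lo <= j < hi ->
    cladder (track b i) (track b' j) =
      (b != b') && ((i <= j.+1) && (j <= i.+1)).
  move=> ri rj; rewrite /cladder !trackE; try lia.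
  by case: ifP => im; case: ifP => jm; case: b; case: b'; case: sw => /=; lia.
have inj b b' i j : lo <= i < hi -> lo <= j < hi ->
    track b i = track b' j -> (b = b') /\ (i = j).
  move=> ri rj /eqP; rewrite track_eqE ?trackE; try lia.
  by case: ifP => im; case: ifP => jm; case: b; case: b'; case: sw => /=; lia.
split=> i j ri rj.
- by rewrite eE.
- by rewrite eE.
- by rewrite eE.
- by case/inj.
- by case/inj.
- by case/inj.
Qed.

Lemma mem_track_strip u a b f : 0 < a -> b <= m.+1 -> f <= m.+1 ->
  (u \in strip (track false) (track true) a b f) =
  [|| ~~ u.2 && (a <= u.1 < b), u.2 && (a < u.1 < f),
      [&& u.1 == 0 :> nat, u.2 == sw, b == m.+1 & a <= m] |
      [&& u.1 == 0 :> nat, u.2 == ~~ sw, f == m.+1 & a < m]].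
Proof.
move=> a0 bm fm; have um := ltn_ord u.1; apply/stripP/idP.
  case=> -[i ri /eqP]; rewrite track_eqE; try lia.
    by case: ifP => im; case: (u.2); case: sw => /=; lia.
  by case: ifP => im; case: (u.2); case: sw => /=; lia.
case/or4P.
- case/andP => u2 ru; left; exists (u.1 : nat) => //; apply/eqP.
  by rewrite track_eqE; [rewrite um eqxx (negPf u2)|lia].
- case/andP => u2 ru; right; exists (u.1 : nat) => //; apply/eqP.
  by rewrite track_eqE; [rewrite um eqxx u2|lia].
- case/and4P => u1 u2 /eqP bE am; left; exists m; first lia.
  by apply/eqP; rewrite track_eqE ?ltnn ?u1 ?addFb.
- case/and4P => u1 u2 /eqP bE am; right; exists m; first lia.
  by apply/eqP; rewrite track_eqE ?ltnn ?u1 ?addTb.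
Qed.

Definition after i : {set T} := [set u : T | u.2 || (i <= u.1)].

(** After y_0, ..., y_(i-1) are deleted and y_i is selected, the vertex y_i is
    isolated, and so is z_k if its three neighbours were all deleted. *)
Definition isolated_part i : {set T} :=
  track false i |: [set u : T | u.2 && (0 < u.1 < i.-1)].

(** Where row b ends after y_i is selected.  For i = 0 the vertex y_0 has a
    neighbour in the last column; for i = 1 the neighbour z_0 disappears; for
    larger i the vertex z_0 remains and prolongs one row beyond column m-1. *)
Definition track_end i b :=
  if i == 0 then m - (b != sw) else if i == 1 then m else m + (b != sw).

Lemma track_end_le i b : track_end i b <= m.+1.
Proof.
by rewrite /track_end; case: (i =P 0) => _; [|case: (i =P 1) => _]; lia.
Qed.

Lemma track_end_gt i b : i < m -> sw || (0 < m0) -> i < track_end i b.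
Proof.
move=> im small; rewrite /track_end.
by case: (i =P 0) => ?; [|case: (i =P 1) => ?];
  case: b; case: sw small => small; rewrite /= in small *; lia.
Qed.

Lemma isolated_partE i u : i < m ->
  (u \in isolated_part i) =
    ~~ u.2 && (u.1 == i :> nat) || u.2 && (0 < u.1 < i.-1).
Proof.
by move=> im; rewrite !inE (track_eqE _ _ (ltnW im)) im; case: (u.2); lia.
Qed.

Lemma card_isolated_part i : i < m -> maxn 1 i.-1 <= #|isolated_part i|.
Proof.
move=> im; rewrite cardsU1 inE !(trackE _ (ltnW im)) im /= add1n.
rewrite (leq_trans (n := i.-2.+1)) ?ltnS //; first by lia.
have inj : injective (fun k : 'I_i.-2 => track true k.+1).
  move=> j k /eqP; rewrite track_eqE; last by have := ltn_ord k; lia.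
  rewrite trackE; last by have := ltn_ord j; lia.
  have := ltn_ord j; have := ltn_ord k => lj lk.
  rewrite ifT; last lia.
  rewrite ifT; last lia.
  by move=> /andP[/eqP [jk] _]; apply: val_inj.
rewrite -[X in X <= _]card_ord -(card_imset _ inj).
apply/subset_leq_card/subsetP => _ /imsetP[k _ ->]; have lk := ltn_ord k.
by rewrite inE !trackE; try lia; rewrite !ifT => //=; lia.
Qed.

Lemma after_del i : i < m -> after i :\ track false i = after i.+1.
Proof.
move=> im; apply/setP => u; rewrite !inE (track_eqE _ _ (ltnW im)) im.
by case: (u.2); lia.
Qed.

Lemma after_nbhd i : i < m -> sw || (0 < m0) ->
  after i :\: nbhd cladder (track false i) =
  isolated_part i :|:
    strip (track false) (track true) i.+1 (track_end i false)
      (track_end i true).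
Proof.
move=> im small; apply/setP => u;
  rewrite in_setU isolated_partE // mem_track_strip //.
- have um := ltn_ord u.1.
  rewrite !inE /cladder !(trackE _ (ltnW im)) im /track_end.
  case: (i =P 0) => i0; [|case: (i =P 1) => i1]; case: (u.2);
    case: sw small => small; rewrite /= in small *;
      move: (nat_of_ord u.1) um => k um; lia.
- exact: track_end_le.
- exact: track_end_le.
Qed.

Lemma isolated_part_indep i : i < m -> sw || (0 < m0) ->
  indep cladder (isolated_part i).
Proof.
move=> im small; apply/indepP => u v; rewrite !isolated_partE // /cladder.
case: (u.2); case: (v.2); case: sw small => small; rewrite /= in small *; lia.
Qed.

Lemma isolated_part_separated i : i < m -> sw || (0 < m0) ->
  separated cladder (isolated_part i)
    (strip (track false) (track true) i.+1 (track_end i false)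
      (track_end i true)).
Proof.
move=> im small u v; rewrite isolated_partE // mem_track_strip //; last 2 first.
- exact: track_end_le.
- exact: track_end_le.
have um := ltn_ord u.1; have vm := ltn_ord v.1.
rewrite /cladder /track_end -pair_eqE /pair_eq /= -val_eqE /=.
case: (i =P 0) => i0; [|case: (i =P 1) => i1];
case: (u.2); case: (v.2); case: sw small => small; rewrite /= in small *;
move: (nat_of_ord u.1) (nat_of_ord v.1) um vm => k l um vm; lia.
Qed.

(** For odd m, rounding up or down depends on whether the alternating set
    [facet] below remains independent when the ladder is closed. *)
Definition cladder_depth : nat :=
  if odd m && (odd (m %/ 2) == sw) then uphalf m else m./2.

Lemma cladder_depth_le i : i < m -> sw || (0 < m0) -> sw || odd m ->
  cladder_depth <= maxn 1 i.-1 +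
    strip_depth (track_end i false - i.+1) (track_end i true - i.+1).
Proof.
move=> im small oddm.
rewrite /cladder_depth /track_end /strip_depth /four_by_two.
case: (i =P 0) => i0; [|case: (i =P 1) => i1];
  case: sw small oddm => small oddm; rewrite /= in small oddm *;
repeat (case: ifP => ?); lia.
Qed.

(** The row of the z_k is independent, except for an edge between its two ends
    if the rows are exchanged. *)
Lemma shedding_after_last : sw || odd m ->
  shedding cladder (after m) cladder_depth.
Proof.
move=> oddm.
have afterE u : (u \in after m) = u.2.
  by rewrite inE; have := ltn_ord u.1; case: (u.2) => //=; lia.
have card_after : #|after m| = m.
  have -> : after m = [set (k, true) | k : 'I_m].
    apply/setP => u; rewrite afterE; apply/idP/imsetP.
      by case: u => k [] // _; exists k.
    by case=> k _ ->.
  by rewrite card_imset ?card_ord // => j k [].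
case: (boolP sw) => swE; last first.
  apply: shedding_indep; last by rewrite card_after /cladder_depth; case: ifP;
    lia.
  apply/indepP => u v; rewrite !afterE /cladder => -> ->.
  by rewrite eqxx (negPf swE) /= andbF.
have z0A : (ord0, true) \in after m by rewrite afterE.
have ltd : cladder_depth < m by rewrite /cladder_depth swE; case: ifP; lia.
apply: (shedding_split z0A); apply: shedding_indep.
- apply/indepP => u v; rewrite !in_setD1 !afterE => /andP[nu u2] /andP[nv v2].
  move: nu nv; rewrite -!pair_eqE /pair_eq /= u2 v2 !andbT -!val_eqE /= =>
    nu nv.
  by rewrite /cladder u2 v2 /= (negPf nu) (negPf nv).
- by have := cardsD1 (ord0, true) (after m); rewrite z0A card_after; lia.
- apply/indepP => u v;
    rewrite !in_setD !afterE !inE => /andP[nu u2] /andP[nv v2].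
  move: nu nv; rewrite /cladder /= u2 v2 swE /= !andbT.
  by have := ltn_ord u.1; have := ltn_ord v.1; lia.
- have lastA : (ord_max, true) \in after m by rewrite afterE.
  have := cardsD1 (ord_max, true) (after m); rewrite lastA card_after.
  move=> cE; apply: (leq_trans (n := #|after m :\ (ord_max, true)|)).
    by rewrite -ltnS (leq_trans ltd) // [X in X <= _]cE add1n.
  apply/subset_leq_card/subsetP => u;
    rewrite in_setD1 in_setD !afterE => /andP[nu u2].
  rewrite u2 andbT inE /cladder /= u2 /=.
  by move: nu; rewrite -pair_eqE /pair_eq /= u2 andbT -val_eqE /=; lia.
Qed.

(** Branch on y_0, y_1, ..., y_(m-1) in turn.  If all are deleted, the row of
    the z_k is left; otherwise the first selected vertex leaves a set of
    isolated vertices and a strip. *)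
Theorem shedding_cladder : sw || (0 < m0) -> sw || odd m ->
  shedding cladder setT cladder_depth.
Proof.
move=> small oddm.
suff sh i : i <= m -> shedding cladder (after (m - i)) cladder_depth.
  have -> : setT = after (m - m); last exact: sh.
  by apply/setP => u; rewrite subnn !inE orbT.
elim: i => [_|i IH lt_im]; first by rewrite subn0; apply: shedding_after_last.
set j := m - i.+1; have jm : j < m by rewrite /j; lia.
apply: (shedding_split (v := track false j)).
- by rewrite inE !trackE ?jm //=; lia.
- rewrite after_del //; have -> : j.+1 = m - i by rewrite /j; lia.
  exact/IH/ltnW.
rewrite after_nbhd //.
apply: (shedding_le (cladder_depth_le jm small oddm)).
apply: (shedding_le (d := #|isolated_part j| +
    strip_depth (track_end j false - j.+1) (track_end j true - j.+1))).
  by rewrite leq_add2r card_isolated_part.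
apply: shedding_indepU; first exact: cladder_sym.
- exact: isolated_part_indep.
- exact: isolated_part_separated.
have e1 : j.+1 + (track_end j false - j.+1) = track_end j false.
  by rewrite subnKC // track_end_gt.
have e2 : j.+1 + (track_end j true - j.+1) = track_end j true.
  by rewrite subnKC // track_end_gt.
rewrite -{1}e1 -{1}e2.
pose hi := if j == 0 then m else m.+1.
apply: (shedding_strip cladder_sym cladder_irr (lo := j.+1) (hi := hi)).
- by apply: cladder_track => //; rewrite /hi; case: (j =P 0) => ?; lia.
- by rewrite /track_end; case: (j =P 0) => ?; [|case: (j =P 1) => ?];
    case: sw small => small; rewrite /= in small *; lia.
- by rewrite /track_end; case: (j =P 0) => ?; [|case: (j =P 1) => ?];
    case: sw small => small; rewrite /= in small *; lia.
- by [].
- by rewrite e1 /hi /track_end; case: (j =P 0) => ?; [|case: (j =P 1) => ?];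
    case: sw small => small; rewrite /= in small *; lia.
- by rewrite e2 /hi /track_end; case: (j =P 0) => ?; [|case: (j =P 1) => ?];
    case: sw small => small; rewrite /= in small *; lia.
Qed.

End CircularLadder.

(** * Cohomology classes of circular ladders *)

Section Certificates.
Variables (m0 : nat) (sw : bool).
Local Notation m := m0.+2.
Local Notation T := ('I_m * bool)%type.
Local Notation cladder := (@cladder m0 sw).
Implicit Types (u v : T).

Definition facet : {set T} :=
  [set u : T | ~~ odd u.1 && (u.2 == odd (u.1 %/ 2))].

Lemma facet_indep : odd m -> odd (m %/ 2) = sw -> indep cladder facet.
Proof.
move=> om sE; apply/indepP => -[i b] [j c]; rewrite !inE /cladder /= -sE.
by case: b; case: c => /=; lia.
Qed.

Lemma facet_dominating v : odd m -> v \notin facet ->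
  exists2 u, u \in facet & cladder u v.
Proof.
case: v => k b om; have km := ltn_ord k; rewrite inE /= => kF.
have [ok|ok] := boolP (odd k); last first.
  exists (k, odd (k %/ 2)); first by rewrite inE /= ok eqxx.
  by move: kF; rewrite ok /cladder /= eq_sym => ->; lia.
have ltk : k < m0.+1 by lia.
have [E|E] := boolP (b == odd (k %/ 2)); last first.
  exists (inord k.-1, odd (k.-1 %/ 2)); first by rewrite inE /= inordK; lia.
  rewrite /cladder /= inordK; last by lia.
  have -> : k.-1 %/ 2 = k %/ 2 by lia.
  by move: E; rewrite eq_sym => ->; lia.
exists (inord k.+1, odd (k.+1 %/ 2)); first by rewrite inE /= inordK; lia.
rewrite /cladder /= inordK; last by lia.
have -> : odd (k.+1 %/ 2) = ~~ odd (k %/ 2) by lia.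
by rewrite (eqP E); case: (odd (k %/ 2)) => /=; lia.
Qed.

Lemma card_facet : odd m -> #|facet| = uphalf m.
Proof.
move=> om.
pose f (j : 'I_(uphalf m)) : T := (inord (2 * j), odd j).
have val_f j : (f j).1 = 2 * j :> nat by rewrite inordK //; have := ltn_ord j;
  lia.
have f_inj : injective f.
  move=> i j E; apply: ord_inj; have := val_f i; rewrite E val_f => h;
    clear E; lia.
have -> : facet = [set f j | j : 'I_(uphalf m)].
  apply/setP => u; rewrite inE; apply/andP/imsetP => [[eu u2]|[j _ ->]];
    last first.
    by rewrite val_f /=; lia.
  have lt : u.1 %/ 2 < uphalf m by have := ltn_ord u.1; lia.
  exists (Ordinal lt) => //; rewrite [LHS]surjective_pairing (eqP u2).
  by congr (_, _); apply: ord_inj; rewrite (val_f (Ordinal lt)) /=; lia.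
by rewrite card_imset // card_ord.
Qed.

Definition column_pair j b : T := (inord (2 * j), b).

Lemma column_pairE j b : j < m./2 -> ((column_pair j b).1 = 2 * j :> nat).
Proof. by move=> ltj; rewrite inordK //; lia. Qed.

(** Two consecutive columns form a 4-cycle, in which both z-vertices are
    adjacent to both y-vertices; hence any choice of one y-vertex in each
    4-cycle dominates all z-vertices. *)
Definition square_block (u : T) : nat := if u.2 then m else u.1 %/ 2.

Lemma square_cert : ~~ odd m -> block_cert cladder
  (fun u => 2 * u.1 + u.2) square_block m./2
  (column_pair^~ false) (column_pair^~ true).
Proof.
move=> em; split.
- move=> [i b] [j c] /= E; have ij : i = j by apply: val_inj => /=; lia.
  by rewrite ij in E *; congr (_, _); move: E; case: b; case: c; lia.
- move=> [i b] [j c]; rewrite /square_block /=.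
  by have := ltn_ord i; have := ltn_ord j; case: b; case: c; lia.
- move=> F [k b] hits _; rewrite /square_block /=; have km := ltn_ord k.
  case: b => [_|]; last by lia.
  have [|[l c] uF] := hits (k %/ 2); first by lia.
  rewrite /square_block /=; case: c uF => uF E; first by lia.
  by exists (l, false) => //; rewrite /cladder /=; lia.
- move=> c d i j ij jD; have iD := ltn_trans ij jD; rewrite /sel.
  by case: c; case: d; rewrite /= !column_pairE //; lia.
- move=> c d i j ij jD; have iD := ltn_trans ij jD; rewrite /sel.
  by case: c; case: d; rewrite /cladder !column_pairE //=; lia.
- by move=> j jD; rewrite /square_block column_pairE //=; lia.
- by move=> j jD; rewrite /square_block /=; lia.
Qed.

(** The j-th block consists of the neighbours of the vertex of column 2j+1 in
    row y if j is odd and in row z if j is even.  Consecutive blocks share the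
    column 2j+2, where they use different rows. *)
Definition star_block (u : T) : nat :=
  if u.2 == odd (u.1 %/ 2) then u.1 %/ 2
  else if odd u.1 || (u.1 == 0 :> nat) then m else (u.1 %/ 2).-1.

(** The centre of each star is adjacent to its whole block.  One more vertex
    remains in column 0 and one in the last column.  A vertex of column 0 is
    dominated unless the transversal uses the last vertex of the first block;
    independence then forces the last vertex of each block, and the last
    vertex of the last block is adjacent to column 0 across the closing edge.
    The vertex of the last column is dominated for the symmetric reason. *)
Lemma star_cert : odd m -> odd (m %/ 2) != sw -> block_cert cladder
  (fun u => 2 * u.1 + (u.2 == odd (u.1 %/ 2))) star_block m./2
  (fun j => column_pair j (odd j)) (fun j => column_pair j (~~ odd j)).
Proof.
move=> om swE; have m2 : m %/ 2 = m./2 by lia.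
have edgeE u v : cladder u v =
  [&& u.2 != v.2, u.1 <= v.1.+1 & v.1 <= u.1.+1] ||
  ((u.1 == 0 :> nat) && (v.1 == m0.+1 :> nat) ||
   (v.1 == 0 :> nat) && (u.1 == m0.+1 :> nat)) &&
  ((u.2 == v.2) (+) odd m./2).
  by rewrite /cladder -m2; case: sw swE; case: (odd _); case: (u.2);
    case: (v.2).
split.
- move=> [i b] [j c] /= E; have ij : i = j by apply: val_inj => /=; lia.
  by rewrite ij in E *; congr (_, _); move: E; case: b; case: c;
    case: (odd _); lia.
- move=> [i b] [j c]; rewrite /star_block /=.
  have := ltn_ord i; have := ltn_ord j.
  by do 2 (case: eqP => /= ?); repeat (case: ifP => ?); lia.
- move=> F [k b] hits /indepP iF; have km := ltn_ord k => bD.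
  have hit j : j < m./2 ->
      exists u, [/\ u \in F, u.2 = odd j & 2 * j <= u.1 <= 2 * j + 2].
    move=> jD; have [u uF uB] := hits j jD; exists u; split=> //.
      by move: uB; rewrite /star_block; case: ifP => [/eqP E|/eqP ne];
        [|case: ifP => ?] => uB; lia.
    by move: uB; rewrite /star_block; case: ifP => [/eqP E|/eqP ne];
      [|case: ifP => ?] => uB; lia.
  have [D ED] : {D | D = m./2} by exists m./2.
  rewrite -ED in bD hit edgeE *; have Dm : m = (2 * D).+1 by lia.
  have D0 : 0 < D by lia.
  have vcases : [\/ odd k /\ b != odd (k %/ 2), k = 0 :> nat /\ b |
      k = m0.+1 :> nat /\ b = odd D].
    move: bD; rewrite /star_block /=; case: ifP => [/eqP E|/eqP ne].
      move=> kD; apply: Or33; split; first by lia.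
      by rewrite E; congr odd; lia.
    case: ifP => [/orP[ok|/eqP k0] _|]; last by lia.
      by apply: Or31.
    by apply: Or32; split=> //; rewrite k0 in ne; case: b ne.
  case: vcases => [[ok bk]|[k0 b1]|[kD bE]].
  - have [|u [uF u2 ru]] := hit (k %/ 2); first by lia.
    by exists u => //; rewrite edgeE /= u2 eq_sym bk; lia.
  - (* If F misses the neighbours of (0, true) in columns 0 and 1, its vertex
       in the first star sits in column 2, which forces the vertex in the
       second star into column 4, and so on up to the last column. *)
    have chain j : j < D -> (exists2 u, u \in F & (u.1 <= 1) && ~~ u.2) \/
        (exists u, [/\ u \in F, u.2 = odd j & u.1 = 2 * j + 2 :> nat]).
      elim: j => [|j IH] jD.
        have [u [uF u2 ru]] := hit 0 jD.
        have [u1|u1] := leqP u.1 1; first by left; exists u => //;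
          rewrite u1 u2.
        by right; exists u; split=> //; lia.
      case: (IH (ltnW jD)) => [|[u [uF u2 u1]]]; first by left.
      have [w [wF w2 rw]] := hit j.+1 jD.
      right; exists w; split=> //; have := iF u w uF wF.
      by rewrite edgeE u2 w2 /=; case: (odd j) => /=; lia.
    have [|[u uF /andP[u1 u2]]|[u [uF u2 u1]]] := chain D.-1; first by lia.
      by exists u => //; rewrite edgeE /= k0 b1 (negPf u2) u1.
    exists u => //; rewrite edgeE /= b1 u2 k0 eqb_id.
    have -> : odd D = ~~ odd D.-1 by lia.
    by case: (odd D.-1) => /=; lia.
  - (* The same chain, run downwards from the last star to the first. *)
    have chain i : i < D ->
        (exists2 u, u \in F & (2 * D <= u.1.+1) && (u.2 == ~~ odd D)) \/
        (exists u, [/\ u \in F, u.2 = odd (D.-1 - i) &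
                       u.1 = 2 * (D.-1 - i) :> nat]).
      elim: i => [|i IH] iD.
        have [|u [uF u2 ru]] := hit D.-1; first by lia.
        have [u1|u1] := leqP (2 * D) u.1.+1.
          by left; exists u => //; rewrite u1 u2; lia.
        by right; exists u; rewrite subn0; split=> //; lia.
      case: (IH (ltnW iD)) => [|[u [uF u2 u1]]]; first by left.
      have [|w [wF w2 rw]] := hit (D.-1 - i.+1); first by lia.
      right; exists w; split=> //; have := iF u w uF wF.
      rewrite edgeE u2 w2; have -> : odd (D.-1 - i) = ~~ odd (D.-1 - i.+1)
        by lia.
      by case: (odd _) => /=; lia.
    have [|[u uF /andP[u1 /eqP u2]]|[u [uF u2 u1]]] := chain D.-1; first by lia.
      have um := ltn_ord u.1; exists u => //; rewrite edgeE /= kD bE u2.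
      by case: (odd D); rewrite /= ltnW // (leq_trans _ u1) //; lia.
    exists u => //; rewrite edgeE /= bE u2 u1 subnn.
    by case: (odd D) => /=; lia.
- move=> c d i j ij jD; have iD := ltn_trans ij jD; rewrite /sel.
  by case: c; case: d; rewrite /= !column_pairE //; lia.
- move=> c d i j ij jD; have iD := ltn_trans ij jD; rewrite /sel.
  by case: c; case: d; rewrite edgeE !column_pairE //=; lia.
- move=> j jD; rewrite /star_block column_pairE //=;
    have -> : 2 * j %/ 2 = j by lia.
  by rewrite eqxx.
- move=> j jD; rewrite /star_block column_pairE //=;
    have -> : 2 * j %/ 2 = j by lia.
  by case: (odd j) => /=; case: ifP; lia.
Qed.

End Certificates.

(** * Disjoint copies *)

Section Copies.
Variables (q g : nat) (T : finType) (e : rel T) (G : sgraph 'I_q).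
Variables (phi : 'I_g * T -> 'I_q) (psi : 'I_q -> 'I_g * T).
Hypotheses (phiK : cancel phi psi) (psiK : cancel psi phi).
Hypothesis phi_edge : forall x y, G (phi x) (phi y) = (x.1 == y.1) && e x.2 y.2.

Lemma edge_psi u v : G u v = ((psi u).1 == (psi v).1) && e (psi u).2 (psi v).2.
Proof. by rewrite -phi_edge !psiK. Qed.

Lemma shedding_copies d : shedding e setT d -> shedding G setT (g * d).
Proof.
move=> sT; pose U c : {set 'I_q} := [set v | (psi v).1 < c].
suff sU c : c <= g -> shedding G (U c) (c * d).
  have -> : setT = U g by apply/setP => v; rewrite !inE ltn_ord.
  exact: sU.
elim: c => [_|c IH lt_cg].
  apply: shedding_indep => //; apply/indepP => u v; rewrite !inE.
  by rewrite ltn0.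
pose f x := phi (Ordinal lt_cg, x).
have fP v : reflect (exists x, v = f x) ((psi v).1 == c :> nat).
  apply: (iffP eqP) => [E|[x ->]]; last by rewrite phiK.
  exists (psi v).2; rewrite /f -[LHS]psiK; congr phi.
  by rewrite [LHS]surjective_pairing; congr (_, _); apply: ord_inj.
have -> : U c.+1 = U c :|: f @: setT.
  apply/setP => v; rewrite in_setU !inE ltnS leq_eqVlt orbC; congr (_ || _).
  by apply/fP/imsetP => [[x ->]|[x _ ->]]; exists x.
rewrite mulSnr; apply: shedding_union; first exact: (edge_sym G).
- move=> u _ uU /imsetP[x _ ->]; rewrite inE in uU.
  have ne : (psi u).1 != (psi (f x)).1.
    by rewrite phiK -val_eqE /=; case: ltngtP uU.
  by rewrite edge_psi (negPf ne) andbT; apply: contra ne => /eqP ->.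
- exact/IH/ltnW.
- apply: shedding_imset sT => [x y /(can_inj phiK) [] //|x y].
  by rewrite phi_edge eqxx.
Qed.

Definition copies_facet (A : {set T}) : {set 'I_q} := phi @: setX setT A.

Lemma mem_copies_facet A v : (v \in copies_facet A) = ((psi v).2 \in A).
Proof.
rewrite -{1}[v]psiK mem_imset; last exact: can_inj phiK.
by rewrite [psi v]surjective_pairing in_setX in_setT.
Qed.

Lemma card_copies_facet A : #|copies_facet A| = g * #|A|.
Proof.
rewrite card_imset; last exact: can_inj phiK.
by rewrite cardsX cardsT card_ord.
Qed.

Lemma copies_facet_indep A : indep e A -> indep G (copies_facet A).
Proof.
move=> /indepP iA; apply/indepP => u v; rewrite !mem_copies_facet => uA vA.
by rewrite edge_psi negb_and iA ?orbT.
Qed.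

Lemma copies_facet_dominating (A : {set T}) :
  (forall x, x \notin A -> exists2 y, y \in A & e y x) ->
  forall v, v \notin copies_facet A -> exists2 u, u \in copies_facet A & G u v.
Proof.
move=> domA v; rewrite mem_copies_facet => /domA[y yA yv].
exists (phi ((psi v).1, y)); first by rewrite mem_copies_facet phiK.
by rewrite edge_psi phiK eqxx.
Qed.

(** Blocks, pairs and ranks of the copies are put one after the other. *)
Section CopiesBlocks.
Variables (rk B : T -> nat) (D R : nat) (a b : nat -> T) (c0 : 'I_g).
Hypothesis cert : block_cert e rk B D a b.
Hypothesis rk_lt : forall x, rk x < R.

Definition copies_rk v := (psi v).1 * R + rk (psi v).2.

Definition copies_block v :=
  if B (psi v).2 < D then (psi v).1 * D + B (psi v).2 else g * D.

Definition copies_vertex (s : nat -> T) j :=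
  phi (insubd c0 (j %/ D), s (j %% D)).

Lemma block_ltP c j k l : k < D -> l < D ->
  (c * D + k < j * D + l) = (c < j) || (c == j) && (k < l).
Proof.
move=> kD lD; case: (ltngtP c j) => [lt|lt|->] /=; last by rewrite ltn_add2l.
  by apply: leq_trans (leq_addr _ _); have := leq_mul lt (leqnn D);
    rewrite mulSnr; lia.
by have := leq_mul lt (leqnn D); rewrite mulSnr; lia.
Qed.

Lemma copies_vertexE s j : j < g * D ->
  [/\ 0 < D, (psi (copies_vertex s j)).1 = j %/ D :> nat &
      (psi (copies_vertex s j)).2 = s (j %% D)].
Proof.
move=> lt; have D0 : 0 < D by rewrite lt0n; apply: contraTneq lt => ->;
  rewrite muln0.
by rewrite /copies_vertex phiK; split=> //=; rewrite val_insubd ltn_divLR // lt.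
Qed.

Lemma copies_sel c j : sel (copies_vertex a) (copies_vertex b) c j =
  copies_vertex (sel a b c) j.
Proof. by rewrite /sel; case: c. Qed.

Lemma div_mod_ltn i j : 0 < D -> i < j ->
  (i %/ D < j %/ D) || (i %/ D == j %/ D) && (i %% D < j %% D).
Proof.
move=> D0 ij; rewrite -(block_ltP _ _ (ltn_pmod i D0) (ltn_pmod j D0)).
by rewrite -!divn_eq.
Qed.

Lemma block_cert_copies : block_cert G copies_rk copies_block (g * D)
  (copies_vertex a) (copies_vertex b).
Proof.
case: cert => rk_inj rk_block dom rk_sel sel_indep B_a B_b.
have rk_ltP (i j k l : nat) : k < R -> l < R -> i < j -> i * R + k < j * R + l.
  by move=> kR lR lt; have := leq_mul lt (leqnn R); rewrite mulSnr; lia.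
split.
- move=> u v; rewrite /copies_rk => E; apply: (can_inj psiK).
  have E1 : (psi u).1 = (psi v).1.
    apply: ord_inj; case: (ltngtP (psi u).1 (psi v).1) => // lt.
      by have := rk_ltP _ _ _ _ (rk_lt (psi u).2) (rk_lt (psi v).2) lt;
        rewrite E ltnn.
    by have := rk_ltP _ _ _ _ (rk_lt (psi v).2) (rk_lt (psi u).2) lt;
      rewrite E ltnn.
  move: E; rewrite E1 => /addnI /rk_inj E2.
  by rewrite [LHS]surjective_pairing E1 E2 -surjective_pairing.
- move=> u v; rewrite /copies_block /copies_rk.
  case: ifP => ku; case: ifP => kv; rewrite ?ltnn //; last by rewrite ltnNge;
    lia.
  rewrite block_ltP // => /orP[lt _|/andP[/eqP E lt] _]; first exact: rk_ltP.
  by rewrite E ltn_add2l rk_block.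
- move=> F v hits /indepP iF; rewrite /copies_block.
  have cv := ltn_ord (psi v).1.
  case: ifP => [Bv|/negbT]; rewrite -?leqNgt => leD.
    by have := leq_mul cv (leqnn D); rewrite mulSnr; lia.
  have [||y] := dom [set y | phi ((psi v).1, y) \in F] (psi v).2 _ _ leD.
  + move=> j jD; have [|u uF] := hits ((psi v).1 * D + j).
      by have := leq_mul cv (leqnn D); rewrite mulSnr; lia.
    rewrite /copies_block; case: ifP => [Bu E|_ E]; last first.
      by have := leq_mul cv (leqnn D); rewrite mulSnr; lia.
    have E1 : (psi u).1 = (psi v).1.
      apply: ord_inj; case: (ltngtP (psi u).1 (psi v).1) => // lt.
        by have := leq_mul lt (leqnn D); rewrite mulSnr; lia.
      by have := leq_mul lt (leqnn D); rewrite mulSnr; lia.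
    exists (psi u).2; first by rewrite inE -E1 -surjective_pairing psiK.
    by move: E; rewrite E1 => /addnI.
  + apply/indepP => x y; rewrite !inE => xF yF.
    by have := iF _ _ xF yF; rewrite phi_edge eqxx.
  rewrite inE => yF yv; exists (phi ((psi v).1, y)) => //.
  by rewrite edge_psi phiK eqxx.
- move=> c d i j ij jD; have iD := ltn_trans ij jD.
  rewrite !copies_sel /copies_rk.
  have [D0 -> ->] := copies_vertexE (sel a b c) iD.
  have [_ -> ->] := copies_vertexE (sel a b d) jD.
  case/orP: (div_mod_ltn D0 ij) => [lt|/andP[/eqP -> lt]]; first exact: rk_ltP.
  by rewrite ltn_add2l rk_sel // ltn_pmod.
- move=> c d i j ij jD; have iD := ltn_trans ij jD.
  rewrite !copies_sel edge_psi -val_eqE /=.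
  have [D0 -> ->] := copies_vertexE (sel a b c) iD.
  have [_ -> ->] := copies_vertexE (sel a b d) jD.
  case/orP: (div_mod_ltn D0 ij) => [|/andP[/eqP -> lt]]; first by case: ltngtP.
  by rewrite eqxx sel_indep // ltn_pmod.
- move=> j jD; rewrite /copies_block; have [D0 -> ->] := copies_vertexE a jD.
  by rewrite B_a ltn_pmod // -divn_eq.
- move=> j jD; rewrite /copies_block; have [D0 -> ->] := copies_vertexE b jD.
  case: ifP => [Bb _|_]; last by rewrite ltnn.
  by rewrite [X in _ < X](divn_eq j D) ltn_add2l B_b // ltn_pmod.
Qed.

End CopiesBlocks.
End Copies.

Theorem edge_depth_cladder_copies (K : fieldType) (q g m0 : nat) (sw : bool)
    (G : sgraph 'I_q) (phi : 'I_g * ('I_m0.+2 * bool) -> 'I_q) :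
  bijective phi ->
  (forall x y, G (phi x) (phi y) = (x.1 == y.1) && cladder sw x.2 y.2) ->
  0 < g -> sw || (0 < m0) -> sw || odd m0 ->
  edge_depth K G (g * cladder_depth m0 sw).
Proof.
case=> psi phiK psiK phi_edge g0 small oddm; split.
  exists (esym_seq K q (g * cladder_depth m0 sw)); last by rewrite size_mkseq.
  apply: regular_seq_of_shedding; apply: (shedding_copies phiK psiK phi_edge).
  by apply: shedding_cladder => //=; rewrite negbK.
move=> fs reg; rewrite /cladder_depth.
case: ifP => [/andP[om /eqP sE]|nf].
  rewrite -(card_facet om) -(card_copies_facet phiK).
  apply: regular_seq_le_facet reg.
    by apply: (copies_facet_indep phiK psiK phi_edge); apply: facet_indep.
  apply: (copies_facet_dominating phiK psiK phi_edge) => v.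
  exact: facet_dominating.
pose c0 : 'I_g := Ordinal g0.
have [om|em] := boolP (odd m0.+2); last first.
  apply: (regular_seq_le_blocks
    (block_cert_copies phiK psiK phi_edge c0 (square_cert sw em)
      (R := 2 * m0.+2) _)) reg.
  by move=> [i b] /=; have := ltn_ord i; case: b; lia.
have sE : odd (m0.+2 %/ 2) != sw by move: nf; rewrite om /= => ->.
apply: (regular_seq_le_blocks
  (block_cert_copies phiK psiK phi_edge c0 (star_cert om sE)
    (R := 2 * m0.+2) _)) reg.
by move=> [i b] /=; have := ltn_ord i; case: eqP; lia.
Qed.

End Combinatorics.

(** * Cubic circulant graphs are copies of circular ladders *)

Lemma mulz_lt_bound (k t N : int) : 0 < N -> `|t * N| < k * N -> `|t| < k.
Proof. by move=> N0; rewrite normrM (gtr0_norm N0) ltr_pM2r. Qed.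

Lemma dvdz_sub_small (N c d : nat) : (c < N)%N -> (d < N)%N ->
  (Posz N %| Posz d - Posz c)%Z -> c = d.
Proof.
move=> cN dN /dvdzP[t E]; have N0 : 0 < Posz N by lia.
have t1 : `|t| < 1 by apply: (mulz_lt_bound N0); rewrite -E; lia.
have t0 : t = 0 by clear E; lia.
by rewrite t0 mul0r in E; lia.
Qed.

Lemma dvdz_le_cases (N : nat) (k : int) : (0 < N)%N -> `|k| <= Posz N ->
  (Posz N %| k)%Z -> [|| k == 0, k == Posz N | k == - Posz N].
Proof.
move=> N0 kN /dvdzP[t E]; have N0' : 0 < Posz N by lia.
have t2 : `|t| < 2 by apply: (mulz_lt_bound N0'); rewrite -E; lia.
have : t = 0 \/ t = 1 \/ t = -1 by clear E; lia.
by case=> [t0|[t0|t0]]; rewrite t0 in E; lia.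
Qed.

Lemma dvd2z (eps : int) : (2%:Z %| eps)%Z = ~~ odd `|eps|%N.
Proof. by rewrite dvdzE dvdn2. Qed.

Lemma dvd2zD (s : nat) (eps : int) :
  (2%:Z %| Posz s + eps)%Z = (odd s == odd `|eps|%N).
Proof.
by rewrite dvd2z; case: eps => k; lia.
Qed.

Section CirculantIso.
Variables (g m0 alpha : nat).
Local Notation m := m0.+2.
Hypotheses (g_gt0 : (0 < g)%N) (co_alpha : coprime alpha m).
Hypotheses (alpha_gt0 : (0 < alpha)%N) (alpha_lt : (alpha < m)%N).
Let n := (g * m)%N.
Let a := (g * alpha)%N.
Let sw := odd (alpha + m).

Lemma circulant_edgeE (i j : 'I_(2 * n)) :
  circulant_edge [:: a; n] i j =
  [|| (Posz (2 * n) %| Posz j - Posz i - Posz a)%Z,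
      (Posz (2 * n) %| Posz i - Posz j - Posz a)%Z |
      (Posz (2 * n) %| Posz j - Posz i - Posz n)%Z].
Proof.
have a0 : (0 < a)%N by rewrite /a muln_gt0 g_gt0.
have an : (a < n)%N by rewrite /a /n ltn_pmul2l.
move: (ltn_ord i) (ltn_ord j); rewrite /circulant_edge -val_eqE /= !inE.
move: (nat_of_ord i) (nat_of_ord j) => k l kn ln.
have dv (d : int) : - (3 * n)%:Z < d -> d < (2 * n)%:Z ->
    (Posz (2 * n) %| d)%Z = (d == 0) || (d == - (2 * n)%:Z).
  move=> lo hi; apply/dvdzP/orP => [[t dE]|[/eqP ->|/eqP ->]].
  - have [t0|t1] : t = 0 \/ t = -1.
      have N0 : 0 <= Posz (2 * n) by [].
      have t1 : t < 1.
        by rewrite ltNge; apply/negP => t1; have := ler_peMl N0 t1; lia.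
      have t2 : -2 < t.
        by rewrite ltNge; apply/negP => t2; have := ler_wpM2r N0 t2; lia.
      by lia.
    by left; rewrite dE t0 mul0r.
    by right; rewrite dE t1 mulN1r.
  - by exists 0; lia.
  - by exists (-1); lia.
rewrite !dv; try lia.
Qed.

(** Modulo g only d - c remains, so c = d.  After division by g the sum is
    kappa (alpha + m) + eps m modulo 2 m, and alpha + m is prime to m: hence m
    divides kappa, which leaves kappa = 0, m or - m, and a parity condition. *)
Lemma dvd_vertex_diff (c d : nat) (kappa eps : int) :
  (c < g)%N -> (d < g)%N -> `|kappa| <= Posz m ->
  (Posz (2 * n) %| Posz d - Posz c
     + kappa * (Posz a + Posz n) + eps * Posz n)%Z =
  (c == d) && ((kappa == 0) && (2%:Z %| eps)%Z ||
    ((kappa == Posz m) || (kappa == - Posz m)) &&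
      (2%:Z %| Posz (alpha + m) + eps)%Z).
Proof.
move=> cg dg km; pose sigma := Posz (alpha + m).
have aE : Posz a = Posz g * Posz alpha by rewrite /a PoszM.
have nE : Posz n = Posz g * Posz m by rewrite /n PoszM.
have sE : Posz a + Posz n = Posz g * sigma by rewrite aE nE -mulrDr.
have n2E : Posz (2 * n) = Posz g * (2 * Posz m) by rewrite PoszM nE mulrCA.
have g0 : Posz g != 0 by lia.
have m0' : Posz m != 0 by lia.
have divE : (Posz g * (2 * Posz m) %|
     kappa * (Posz g * sigma) + eps * (Posz g * Posz m))%Z
    = (2 * Posz m %| kappa * sigma + eps * Posz m)%Z.
  have -> : kappa * (Posz g * sigma) + eps * (Posz g * Posz m) =
     Posz g * (kappa * sigma + eps * Posz m) by ring.
  by rewrite dvdz_mul2l.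
rewrite sE n2E nE -addrA; case: (eqVneq c d) => [->|ncd] /=; last first.
  apply/negP => dv; have : (Posz g %| Posz d - Posz c)%Z.
    have : (Posz g %| Posz d - Posz c +
        (kappa * (Posz g * sigma) + eps * (Posz g * Posz m)))%Z.
      by apply: dvdz_trans dv; apply: dvdz_mulr.
    have -> : kappa * (Posz g * sigma) + eps * (Posz g * Posz m) =
      (kappa * sigma + eps * Posz m) * Posz g by ring.
    by rewrite rpredDr // dvdz_mull.
  by move=> /(dvdz_sub_small cg dg) cd; rewrite cd eqxx in ncd.
rewrite subrr add0r divE.
have key t : kappa = t * Posz m ->
    (2 * Posz m %| kappa * sigma + eps * Posz m)%Z =
      (2%:Z %| t * sigma + eps)%Z.
  move=> ->; have -> : t * Posz m * sigma + eps * Posz m =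
    (t * sigma + eps) * Posz m by ring.
  by rewrite dvdz_mul2r.
have [k0|kn0] := eqVneq kappa 0.
  by rewrite (key 0) ?mul0r // add0r k0 /= orbF.
have [km'|kmn] := eqVneq kappa (Posz m).
  by rewrite (key 1) ?mul1r // km' eqxx.
have [km''|kmnn] := eqVneq kappa (- Posz m).
  rewrite (key (-1)) ?mulN1r //= -/sigma.
  have -> : - sigma + eps = (sigma + eps) + - sigma * 2 by ring.
  by rewrite rpredDr ?dvdz_mull // eqxx orbT.
apply/negP => dv.
have : (Posz m %| kappa * sigma)%Z.
  have : (Posz m %| kappa * sigma + eps * Posz m)%Z.
    by apply: dvdz_trans dv; apply: dvdz_mull.
  by rewrite rpredDr // dvdz_mull.
rewrite Gauss_dvdzl; last first.
  by rewrite coprimezE /sigma !absz_nat /coprime gcdnDr gcdnC; exact: co_alpha.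
by move/(dvdz_le_cases (ltn0Sn _) km);
  rewrite (negPf kn0) (negPf kmn) (negPf kmnn).
Qed.

(** x.1 numbers the cosets of the subgroup generated by a and n; adding a + n
    moves one column forward in the same row, adding n changes the row. *)
Definition vertex_val (x : 'I_g * ('I_m * bool)) : nat :=
  (x.1 + x.2.1 * (a + n) + x.2.2 * n)%N.

Lemma vertex_lt x : (vertex_val x %% (2 * n) < 2 * n)%N.
Proof. by rewrite ltn_pmod // /n !muln_gt0 g_gt0. Qed.

Definition vertex x : 'I_(2 * n) := Ordinal (vertex_lt x).

Lemma vertex_diff x y (r : int) :
  (Posz (2 * n) %| Posz (vertex x) - Posz (vertex y) + r)%Z =
  (Posz (2 * n) %| Posz x.1 - Posz y.1
     + (Posz x.2.1 - Posz y.2.1) * (Posz a + Posz n)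
     + (Posz x.2.2 - Posz y.2.2) * Posz n + r)%Z.
Proof.
have E z : Posz (vertex z) =
  Posz (vertex_val z) - Posz (vertex_val z %/ (2 * n)) * Posz (2 * n).
  rewrite [X in _ = Posz X - _](divn_eq _ (2 * n)).
  by rewrite PoszD PoszM addrAC subrr add0r.
have shift (u v p p' N : int) :
  u - p * N - (v - p' * N) + r = (u - v + r) + (p' - p) * N by ring.
rewrite !E shift rpredDr; last by apply: dvdz_mull.
have vE z : Posz (vertex_val z) =
    Posz z.1 + Posz z.2.1 * (Posz a + Posz n) + Posz z.2.2 * Posz n by [].
have regroup (c d k l s u v N : int) :
  c + k * s + u * N - (d + l * s + v * N) =
    c - d + (k - l) * s + (u - v) * N by ring.
by rewrite !vE regroup.
Qed.

Lemma vertex_inj : injective vertex.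
Proof.
move=> x y E; have := vertex_diff x y 0; rewrite E subrr !addr0 dvdz0 => /esym.
have := ltn_ord x.2.1; have := ltn_ord y.2.1 => ly lx.
rewrite dvd_vertex_diff ?ltn_ord //; last by lia.
case/andP => /eqP c.
have nm : (Posz x.2.1 - Posz y.2.1 == Posz m) ||
  (Posz x.2.1 - Posz y.2.1 == - Posz m) = false by lia.
rewrite nm orbF => /andP[/eqP k e].
rewrite [x]surjective_pairing [y]surjective_pairing [x.2]surjective_pairing
  [y.2]surjective_pairing.
congr (_, (_, _)); [exact/ord_inj/esym|apply: ord_inj; lia|].
by case: (x.2.2) e; case: (y.2.2).
Qed.

Lemma vertex_bij : bijective vertex.
Proof.
apply: inj_card_bij; first exact: vertex_inj.
by rewrite !card_prod !card_ord card_bool /n; lia.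
Qed.

Lemma vertex_edge x y : circulant (2 * n) [:: a; n] (vertex x) (vertex y) =
  (x.1 == y.1) && cladder sw x.2 y.2.
Proof.
rewrite /= circulant_edgeE.
have E1 (u v : int) : u - v - Posz a =
  u - v + (- (Posz a + Posz n) + Posz n) by ring.
rewrite !E1 !vertex_diff.
have F1 (d c k l e f : int) :
  d - c + (k - l) * (Posz a + Posz n) + (e - f) * Posz n
    + (- (Posz a + Posz n) + Posz n) =
  d - c + (k - l - 1) * (Posz a + Posz n) + (e - f + 1) * Posz n by ring.
have F2 (d c k l e f : int) :
  d - c + (k - l) * (Posz a + Posz n) + (e - f) * Posz n + - Posz n =
  d - c + (k - l) * (Posz a + Posz n) + (e - f - 1) * Posz n by ring.
have lx := ltn_ord x.2.1; have ly := ltn_ord y.2.1.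
rewrite !F1 F2 !dvd_vertex_diff ?ltn_ord //; try lia.
rewrite [(y.1 : nat) == _]eq_sym -!val_eqE /= -!andb_orr; case: eqP => //= _.
rewrite /cladder /sw !dvd2zD !dvd2z; move: (odd (alpha + m)) => par.
move: (nat_of_ord x.2.1) (nat_of_ord y.2.1) lx ly => k l lx ly.
by case: (x.2.2); case: (y.2.2); case: par => /=; lia.
Qed.

End CirculantIso.

(** * The depth formula *)

Lemma ceil_half (k : nat) : Num.ceil (k%:R / 2 : rat) = Posz (uphalf k).
Proof.
apply: ceil_def.
have -> : (k%:R : rat) = (uphalf k)%:R + (k./2)%:R by rewrite -natrD;
  congr _%:R; lia.
have : ((uphalf k)%:R : rat) = (k./2)%:R + (odd k)%:R by rewrite -natrD;
  congr _%:R; lia.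
rewrite rmorphB /= -!pmulrn => ->; case: (odd k) => /=; lra.
Qed.

Lemma edge_depth_circulant (K : fieldType) (g m0 alpha : nat) :
  (0 < g)%N -> coprime alpha m0.+2 -> (0 < alpha)%N -> (alpha < m0.+2)%N ->
  edge_depth K (circulant (2 * (g * m0.+2)) [:: (g * alpha)%N; (g * m0.+2)%N])
    (g * cladder_depth m0 (odd (alpha + m0.+2))).
Proof.
move=> g0 co a0 am.
apply: (edge_depth_cladder_copies K (vertex_bij g0 co a0 am)) => //.
- exact: vertex_edge.
- case: m0 co am => [|m1] //=; last by rewrite orbT.
  by move=> _; case: alpha a0 => [|[|]].
- case: (boolP (odd m0)) => [|em]; first by rewrite orbT.
  rewrite orbF oddD /= negbK (negPf em) addbF; apply: contraLR co => ea.
  apply/negP => co; have : (2 %| gcdn alpha m0.+2)%N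
    by rewrite dvdn_gcd !dvdn2 /= negbK em ea.
  by rewrite (eqP co).
Qed.

Theorem theorem4p9 (K : fieldType) (n a : nat)
  (hn : (2 <= n)%N) (ha : (1 <= a)%N) (han : (a < n)%N) :
  let t := gcdn (2 * n) a in
  let G := circulant (2 * n) [:: a; n] in
  let N : rat := n%:R in
  let T : rat := t%:R in
  exists2 d : nat, edge_depth K G d &
    (~~ odd (2 * n %/ t) ->
       ((n %/ t = 1 %[mod 4])%N ->
          d%:R = (Num.ceil (N / (2 * T)))%:~R * T) /\
       ((n %/ t <> 1 %[mod 4])%N ->
          d%:R = (Num.ceil ((N - T) / (2 * T)))%:~R * T)) /\
    (odd (2 * n %/ t) ->
       ((2 * n %/ t = 1 %[mod 4])%N ->
          d%:R = (Num.ceil ((2 * N - T) / (2 * T)))%:~R * (T / 2)) /\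
       ((2 * n %/ t = 3 %[mod 4])%N ->
          d%:R = (Num.ceil (N / T))%:~R * (T / 2))).
Proof.
have g0 : (0 < gcdn a n)%N by rewrite gcdn_gt0 ha.
have [alpha aE] : {x | a = gcdn a n * x}%N.
  by exists (a %/ gcdn a n)%N; rewrite mulnC divnK ?dvdn_gcdl.
have [m nE] : {x | n = gcdn a n * x}%N.
  by exists (n %/ gcdn a n)%N; rewrite mulnC divnK ?dvdn_gcdr.
have co : coprime alpha m.
  by rewrite /coprime -(eqn_pmul2l g0) muln1 muln_gcdr -aE -nE.
move: (gcdn a n) g0 aE nE => g g0 aE nE; subst a n.
rewrite ltn_pmul2l // in han; rewrite muln_gt0 g0 /= in ha.
case: m hn han co => [|[|m0]] hn han co; [by lia|by lia|].
move=> t G N T; exists (g * cladder_depth m0 (odd (alpha + m0.+2)))%N.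
  exact: edge_depth_circulant.
have gR : (g%:R : rat) != 0 by rewrite pnatr_eq0 -lt0n.
have NE : N = g%:R * m0.+2%:R by rewrite /N natrM.
have tE : t = (g * gcdn 2 alpha)%N.
  rewrite /t mulnCA -muln_gcdr; congr (_ * _)%N.
  by rewrite [in RHS]gcdnC -(@Gauss_gcdl _ 2 m0.+2) 1?gcdnC // coprime_sym.
have [ea|oa] := boolP (odd alpha).
  have {}tE : t = g.
    rewrite tE; have /eqP -> : coprime 2 alpha by rewrite coprime2n.
    by rewrite muln1.
  have TE : T = g%:R by rewrite /T tE.
  have -> : (2 * (g * m0.+2) %/ t = 2 * m0.+2)%N by rewrite tE mulnCA mulKn.
  have -> : (g * m0.+2 %/ t = m0.+2)%N by rewrite tE mulKn.
  rewrite oddM /=; split=> // _; rewrite /cladder_depth; split=> m4.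
    have -> : N / (2 * T) = m0.+2%:R / 2 by rewrite NE TE; field.
    rewrite ceil_half -pmulrn TE -natrM mulnC; congr _%:R.
    case: ifP => // /negP[]; lia.
  have -> : (N - T) / (2 * T) = m0.+1%:R / 2.
    by rewrite NE TE [in LHS]mulrSr; field.
  rewrite ceil_half -pmulrn TE -natrM mulnC; congr _%:R.
  case: ifP => // /andP[om]; lia.
have om : odd m0.+2.
  apply: contraT => em; move: co; rewrite /coprime.
  have : (2 %| gcdn alpha m0.+2)%N by rewrite dvdn_gcd !dvdn2 oa em.
  by move=> /[swap] /eqP ->.
have {}tE : t = (g * 2)%N.
  by rewrite tE; congr (_ * _)%N; apply/gcdn_idPl; rewrite dvdn2.
have TE : T = g%:R * 2 by rewrite /T tE natrM.
have -> : (2 * (g * m0.+2) %/ t = m0.+2)%N.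
  by rewrite tE mulnA [(2 * g)%N]mulnC mulKn // muln_gt0 g0.
split=> [|_]; first by rewrite om.
rewrite /cladder_depth; split=> m4.
  have -> : (2 * N - T) / (2 * T) = m0.+1%:R / 2.
    by rewrite NE TE [in LHS]mulrSr; field.
  rewrite ceil_half -pmulrn TE mulfK // -natrM mulnC; congr _%:R.
  case: ifP => // /andP[_]; lia.
have -> : N / T = m0.+2%:R / 2 by rewrite NE TE; field.
rewrite ceil_half -pmulrn TE mulfK // -natrM mulnC; congr _%:R.
case: ifP => // /negP[]; lia.
Qed.
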